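(* Let $R$ be a principal ideal domain and $f\in R[[X]]$. Then $f$ is irreducible in $R[[X]]$ if and only if one of the following holds: (1) $f_0=0$ and $f_1$ is a unit in $R$; (2) $f_0$ is associate to a power of some prime $\pi\in R$ and, writing $f=\pi^kf'$ with $k\ge 0$ and $f'\in R[[X]]$ not divisible by $\pi$, either (a) $k=1$ and $f'_0$ is a unit in $R$, or (b) $k=0$ and the Weierstrass polynomial $P_{f,\widehat{R}_{(\pi)}}$ is irreducible in $\widehat{R}_{(\pi)}[X]$. Moreover, if $f_0$ is associate to a power of a prime $\pi\in R$ and $\pi\nmid f$ in $R[[X]]$, then $R[[X]]/(f)\cong\widehat{R}_{(\pi)}[X]/(P)$ as $R[X]$-algebras, where $P=P_{f,\widehat{R}_{(\pi)}}$.
   Context: $f_i$ denotes the coefficient of $X^i$. A nonzero element $a$ is prime if $(a)$ is a prime ideal. $\widehat{R}_{(\pi)}$ is the $\pi$-adic completion of $R$. For a ring $S$ complete with respect to the $\mathfrak a$-adic filtration (or more generally some filtration by ideals each containing a power of $\mathfrak a$) and $g\in S[[X]]$ with $g_i\in\mathfrak a$ for $i<n$ and $g_n$ a unit mod $\mathfrak a$, $P_{g,S}$ denotes the unique monic polynomial $P\in S[X]$ with $P_i\in\mathfrak a$ for $i<\deg P$ such that $g=UP$ for a unit $U\in S[[X]]$ (the Weierstrass polynomial associated to $g$). Here $S=\widehat{R}_{(\pi)}$, $\mathfrak a=\pi\widehat{R}_{(\pi)}$; when $\pi\nmid f$ in $R[[X]]$ some coefficient of $f$ is not divisible by $\pi$,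 so $f$ is $\pi\widehat{R}_{(\pi)}$-distinguished of some order in $\widehat{R}_{(\pi)}[[X]]$. *)

(* Defs.v *)
From HB Require Import structures.
From mathcomp Require Import all_boot all_algebra.
Set Implicit Arguments. Unset Strict Implicit. Unset Printing Implicit Defensive.
Import GRing.Theory.
Local Open Scope ring_scope.

Section Defs.
Variable R : idomainType.

Definition dvdR (a b : R) : Prop := exists c : R, b = c * a.
Definition assocR (a b : R) : Prop :=
  exists u : R, u \is a GRing.unit /\ a = u * b.
Definition is_ideal (I : R -> Prop) : Prop :=
  I 0 /\ (forall x y, I x -> I y -> I (x + y)) /\ (forall r x, I x -> I (r * x)).
Definition is_PID : Prop :=
  forall I, is_ideal I -> exists a, forall x, I x <-> dvdR a x.
Definition prime_elt (p : R) : Prop :=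
  p != 0 /\ p \isn't a GRing.unit /\
  forall a b, dvdR p (a * b) -> dvdR p a \/ dvdR p b.

Definition pseries := nat -> R.
Definition ps_eq (f g : pseries) : Prop := forall n, f n = g n.
Definition ps_zero : pseries := fun _ => 0.
Definition ps_one : pseries := fun n => (n == 0%N)%:R.
Definition ps_add (f g : pseries) : pseries := fun n => f n + g n.
Definition ps_sub (f g : pseries) : pseries := fun n => f n - g n.
Definition ps_mul (f g : pseries) : pseries :=
  fun n => \sum_(i < n.+1) f i * g (n - i)%N.
Definition ps_unit (f : pseries) : Prop := exists g, ps_eq (ps_mul f g) ps_one.
Definition ps_irreducible (f : pseries) : Prop :=
  ~ ps_eq f ps_zero /\ ~ ps_unit f /\
  forall g h, ps_eq f (ps_mul g h) -> ps_unit g \/ ps_unit h.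
Definition ps_dvdC (a : R) (f : pseries) : Prop :=
  exists g : pseries, ps_eq f (fun n => a * g n).
Definition ps_of_poly (p : {poly R}) : pseries := fun n => p`_n.
Definition ps_cong (f g h : pseries) : Prop :=
  exists q, ps_eq (ps_sub g h) (ps_mul f q).

(** * The pi-adic completion of R, as the inverse limit of the R/pi^n:
    an element is a compatible system of representatives c n of classes in
    R/pi^n  (c (n+1) = c n mod pi^n), two systems being equal iff
    c n = d n mod pi^n for all n.  Ring operations are levelwise. *)
Variable pi : R.
Definition compl := nat -> R.
Definition cauchy (c : compl) : Prop := forall n, dvdR (pi ^+ n) (c n.+1 - c n).
Definition ceq (c d : compl) : Prop := forall n, dvdR (pi ^+ n) (c n - d n).
Definition cconst (r : R) : compl := fun _ => r.
Definition in_pi_ideal (c : compl) : Prop :=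
  exists d, cauchy d /\ ceq c (fun n => pi * d n).

(** power series over the completion: F i is the coefficient of X^i *)
Definition cps := nat -> compl.
Definition cps_valid (F : cps) : Prop := forall i, cauchy (F i).
Definition cps_eq (F G : cps) : Prop := forall i, ceq (F i) (G i).
Definition cps_zero : cps := fun _ _ => 0.
Definition cps_one : cps := fun i _ => (i == 0%N)%:R.
Definition cps_add (F G : cps) : cps := fun i n => F i n + G i n.
Definition cps_sub (F G : cps) : cps := fun i n => F i n - G i n.
Definition cps_mul (F G : cps) : cps :=
  fun i n => \sum_(j < i.+1) F j n * G (i - j)%N n.
Definition cps_of_ps (f : pseries) : cps := fun i _ => f i.
Definition cps_unit (F : cps) : Prop :=
  exists G, cps_valid G /\ cps_eq (cps_mul F G) cps_one.

Definition cpoly_elt (F : cps) : Prop :=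
  cps_valid F /\ exists N, forall i, (N <= i)%N -> ceq (F i) (cconst 0).
Definition cpoly_unit (F : cps) : Prop :=
  exists G, cpoly_elt G /\ cps_eq (cps_mul F G) cps_one.
Definition cpoly_irreducible (P : cps) : Prop :=
  cpoly_elt P /\ ~ cps_eq P cps_zero /\ ~ cpoly_unit P /\
  forall G H, cpoly_elt G -> cpoly_elt H -> cps_eq P (cps_mul G H) ->
    cpoly_unit G \/ cpoly_unit H.
Definition cpoly_cong (P G H : cps) : Prop :=
  exists Q, cpoly_elt Q /\ cps_eq (cps_sub G H) (cps_mul P Q).

Definition weierstrass_poly (f : pseries) (P : cps) : Prop :=
  cpoly_elt P /\
  (exists d : nat, ceq (P d) (cconst 1) /\
     (forall i, (d < i)%N -> ceq (P i) (cconst 0)) /\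
     (forall i, (i < d)%N -> in_pi_ideal (P i))) /\
  exists U, cps_valid U /\ cps_unit U /\ cps_eq (cps_of_ps f) (cps_mul U P).

(** R[[X]]/(f) ~= completion[X]/(P) as R[X]-algebras, written out via a
    map Phi on representatives inducing a bijective ring morphism of the
    quotients compatible with the structure maps from R[X]. *)
Definition quotient_iso_RX (f : pseries) (P : cps) : Prop :=
  exists Phi : pseries -> cps,
    (forall g, cpoly_elt (Phi g)) /\
    (forall g h, ps_cong f g h <-> cpoly_cong P (Phi g) (Phi h)) /\
    (forall G, cpoly_elt G -> exists g, cpoly_cong P (Phi g) G) /\
    (forall g h, cpoly_cong P (Phi (ps_add g h)) (cps_add (Phi g) (Phi h))) /\
    (forall g h, cpoly_cong P (Phi (ps_mul g h)) (cps_mul (Phi g) (Phi h))) /\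
    cpoly_cong P (Phi ps_one) cps_one /\
    (forall p : {poly R},
        cpoly_cong P (Phi (ps_of_poly p)) (cps_of_ps (ps_of_poly p))).

End Defs.

(* Main.v *)
Require Import Defs.
From HB Require Import structures.
From mathcomp Require Import all_boot all_algebra boolp ring zify.
Import GRing.Theory.
Local Open Scope ring_scope.

Set Implicit Arguments.
Unset Strict Implicit.
Unset Printing Implicit Defensive.

(** Write [S] for the completion of [R] at [pi].  If the constant term of a
    series [G] over [S] is associate to a power of [pi], then every series over
    [S] is congruent modulo [G] to a series over [R], because [S = R + pi^i S]
    and [pi^i] is a multiple of [X] modulo [G]; in particular [G] itself is
    associate to a series over [R].  Conversely a quotient in [S[[X]]] of two
    series over [R], the divisor having such a constant term, lies in [R[[X]]].
    Hence factorizations of [f] and of its Weierstrass polynomial [P]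
    correspond to each other, and [R[[X]]/(f)] is [S[[X]]/(P)].  The passage
    between [S[X]] and [S[[X]]] rests on Weierstrass division and on the fact
    that a power series whose product with [P] is a polynomial is itself a
    polynomial.  When [f] is irreducible and its constant term is a nonzero
    product of two coprime elements, Bezout relations lift this factorization
    to [f], so that the constant term is a prime power up to a unit. *)

(** Stage [n + 1] of the construction changes stage [n] only at position [n]. So the diagonal of the
    stages agrees with stage [n + 1] on all indices up to [n], the only ones that [P n] sees. *)
Lemma course_of_values (T : Type) (x0 : T) (P : nat -> (nat -> T) -> Prop) :
  (forall n s s', (forall i, (i <= n)%N -> s i = s' i) -> P n s -> P n s') ->
  (forall n s, exists t, P n (fun i => if i == n then t else s i)) ->
  exists s, forall n, P n s.
Proof.
move=> Pext Pex.
have [F FP] := choice (fun ns : nat * (nat -> T) => Pex ns.1 ns.2).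
pose upd n (s : nat -> T) i := if i == n then F (n, s) else s i.
pose s_ := fix s_ n := if n is n'.+1 then upd n' (s_ n') else fun _ => x0.
have stab n k i : (i < n)%N -> s_ (n + k)%N i = s_ n i.
  move=> lt_in; elim: k => [|k IHk]; first by rewrite addn0.
  by rewrite addnS /= /upd ifN ?IHk //; lia.
exists (fun i => s_ i.+1 i) => n.
apply: Pext (FP (n, s_ n)) => i le_in.
rewrite -[LHS]/(s_ n.+1 i) -(stab i.+1 (n - i)%N) //.
by congr (s_ _ i); rewrite addSn subnKC.
Qed.

(** * Power series over a commutative ring *)

(** Unfolds to [nat -> S], as [pseries] does, so that the series of the statement are elements of
    the ring built below. *)
Definition ps (S : Type) := nat -> S.

Section PowerSeriesRing.
Variable S : comPzRingType.
Implicit Types f g h : ps S.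

HB.instance Definition _ := gen_eqMixin (ps S).
HB.instance Definition _ := gen_choiceMixin (ps S).

Lemma psP f g : (forall n, f n = g n) <-> f = g.
Proof. by split=> [fg|-> //]; apply/funext. Qed.

Let zero : ps S := fun _ => 0.
Let one : ps S := fun n => (n == 0%N)%:R.
Let add f g : ps S := fun n => f n + g n.
Let opp f : ps S := fun n => - f n.
Let mul f g : ps S := fun n => \sum_(i < n.+1) f i * g (n - i)%N.

Let addA : associative add.
Proof. by move=> f g h; apply/psP => n; rewrite /add addrA. Qed.
Let addC : commutative add.
Proof. by move=> f g; apply/psP => n; rewrite /add addrC. Qed.
Let add0 : left_id zero add.
Proof. by move=> f; apply/psP => n; rewrite /add add0r. Qed.
Let addN : left_inverse zero opp add.
Proof. by move=> f; apply/psP => n; rewrite /add addNr. Qed.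

HB.instance Definition _ := GRing.isZmodule.Build (ps S) addA addC add0 addN.

Let mulC : commutative mul.
Proof.
move=> f g; apply/psP => n; rewrite /mul (reindex_inj rev_ord_inj) /=.
by apply: eq_bigr => i _; rewrite mulrC; congr (g _ * f _); have := ltn_ord i; lia.
Qed.

Let mulA : associative mul.
Proof.
move=> f g h; apply/psP => n; rewrite [in RHS]mulC /mul.
(* Both sides are the sum of [c j k] over all [j + k <= n]. *)
pose c j k := f j * (g (n - j - k)%N * h k).
transitivity (\sum_(j < n.+1) \sum_(k < n.+1 | (k <= n - j)%N) c j k).
  apply: eq_bigr => j _; rewrite -[X in _ * X]/(mul _ _ _) mulC /mul big_distrr /=.
  rewrite (big_ord_narrow_leq (leq_subr _ _)) /=.
  by apply: eq_bigr => k _; rewrite /c [h _ * _]mulrC.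
rewrite (exchange_big_dep predT) //=; apply: eq_bigr => k _.
transitivity (\sum_(j < n.+1 | (j <= n - k)%N) c j k).
  by apply: eq_bigl => j; have := ltn_ord j; have := ltn_ord k; lia.
rewrite (big_ord_narrow_leq (leq_subr _ _)) big_distrr /=.
apply: eq_bigr => j _; rewrite /c mulrA mulrC; congr (_ * (_ * g _)).
by have := ltn_ord j; have := ltn_ord k; lia.
Qed.

Let mul1 : left_id one mul.
Proof.
move=> f; apply/psP => n; rewrite /mul big_ord_recl /= mul1r subn0 big1 ?addr0 //.
by move=> i _; rewrite mul0r.
Qed.

Let mulD : left_distributive mul add.
Proof.
move=> f g h; apply/psP => n; rewrite /mul /add -big_split.
by apply: eq_bigr => i _; rewrite mulrDl.
Qed.

HB.instance Definition _ := GRing.Zmodule_isComPzRing.Build (ps S)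
  mulA mulC mul1 mulD.

Lemma ps0E n : (0 : ps S) n = 0. Proof. by []. Qed.
Lemma ps1E n : (1 : ps S) n = (n == 0%N)%:R. Proof. by []. Qed.
Lemma psDE f g n : (f + g) n = f n + g n. Proof. by []. Qed.
Lemma psBE f g n : (f - g) n = f n - g n. Proof. by []. Qed.
Lemma psME f g n : (f * g) n = \sum_(i < n.+1) f i * g (n - i)%N.
Proof. by []. Qed.

Lemma psM0E f g : (f * g) 0%N = f 0%N * g 0%N.
Proof. by rewrite psME big_ord1. Qed.

Lemma ps_sumE (I : Type) (r : seq I) (F : I -> ps S) n :
  (\sum_(i <- r) F i) n = \sum_(i <- r) F i n.
Proof.
by elim: r => [|i r IHr]; rewrite ?big_nil // !big_cons psDE IHr.
Qed.

Definition psC (c : S) : ps S := fun n => if n == 0%N then c else 0.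

Lemma psCME c f n : (psC c * f) n = c * f n.
Proof.
by rewrite psME big_ord_recl /= subn0 big1 ?addr0 // => i _; rewrite mul0r.
Qed.

Lemma psC1 : psC 1 = 1.
Proof. by apply/psP => -[|n]. Qed.

Lemma psCX c n : psC (c ^+ n) = psC c ^+ n.
Proof.
elim: n => [|n IHn]; first by rewrite psC1.
rewrite !exprS -IHn; apply/psP => k; rewrite psCME /psC.
by case: eqP; rewrite ?mulr0.
Qed.

Definition psXn d : ps S := fun n => (n == d)%:R.

Lemma psXnME d f n : (psXn d * f) n = if (n < d)%N then 0 else f (n - d)%N.
Proof.
rewrite psME; case: ltnP => [lt_nd|le_dn].
  rewrite big1 // => i _; rewrite /psXn; case: eqP => [eq_id|_]; last exact: mul0r.
  by have := ltn_ord i; lia.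
rewrite (bigD1 (inord d)) //= inordK // /psXn eqxx mul1r big1 ?addr0 // => i.
by rewrite -val_eqE /= inordK // => /negPf->; rewrite mul0r.
Qed.

Definition psshift d f : ps S := fun n => f (n + d)%N.

Lemma psshiftD d f g : psshift d (f + g) = psshift d f + psshift d g.
Proof. by []. Qed.

Lemma psshiftC d c f : psshift d (psC c * f) = psC c * psshift d f.
Proof. by apply/psP => n; rewrite psCME /psshift psCME. Qed.

Lemma psshiftXn d f : psshift d (psXn d * f) = f.
Proof. by apply/psP => n; rewrite /psshift psXnME ifN ?addnK //; lia. Qed.

(** One notion of unit for the base ring, the completion and the series over either. *)
Definition invertible (A : comPzRingType) (x : A) := exists y, x * y = 1.

(** The coefficients of the inverse are found one by one: in degree [n] the equation prescribes
    [f 0 * s n] in terms of earlier coefficients. *)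
Lemma ps_invertible f : invertible f <-> invertible (f 0%N).
Proof.
split=> [[g fg]|[y fy]].
  by exists (g 0%N); rewrite -psM0E fg.
have [n s s' eqs|n s|g gP] := @course_of_values S 0
  (fun n s => \sum_(i < n.+1) f i * s (n - i)%N = (n == 0%N)%:R).
- by move=> <-; apply: eq_bigr => i _; rewrite eqs // leq_subr.
- exists (y * ((n == 0%N)%:R - \sum_(i < n) f i.+1 * s (n - i.+1)%N)).
  rewrite big_ord_recl /= subn0 eqxx mulrA fy mul1r -[RHS](subrK
    (\sum_(i < n) f i.+1 * s (n - i.+1)%N)); congr (_ + _).
  by apply: eq_bigr => i _; rewrite ifN //= /bump; have := ltn_ord i; lia.
- by exists g; apply/psP.
Qed.

(** Polynomials stay inside the ring of series, so that factorizations in [S[X]] and [S[[X]]] can be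
    compared directly. *)
Definition is_poly f := exists N, forall i, (N <= i)%N -> f i = 0.

Lemma is_polyM f g : is_poly f -> is_poly g -> is_poly (f * g).
Proof.
move=> [M fM] [N gN]; exists (M + N)%N => i le_i; rewrite psME big1 // => j _.
have [le_Mj|lt_jM] := leqP M j; first by rewrite fM ?mul0r.
by rewrite gN ?mulr0 //; have := ltn_ord j; lia.
Qed.

End PowerSeriesRing.

Lemma invertibleM (A : comPzRingType) (x y : A) :
  invertible (x * y) <-> invertible x /\ invertible y.
Proof.
split=> [[z xyz]|[[x' xx'] [y' yy']]].
  by split; [exists (y * z)|exists (x * z)]; rewrite -xyz; ring.
by exists (x' * y'); rewrite mulrACA xx' yy' mulr1.
Qed.

Lemma invertible1 (A : comPzRingType) : invertible (1 : A).
Proof. by exists 1; rewrite mulr1. Qed.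

Section MapSeries.
Variables (A B : comPzRingType) (iota : {rmorphism A -> B}).

Definition psmap (f : ps A) : ps B := fun n => iota (f n).

Lemma psmapM f g : psmap (f * g) = psmap f * psmap g.
Proof.
apply/psP => n; rewrite /psmap !psME rmorph_sum.
by apply: eq_bigr => i _; rewrite rmorphM.
Qed.

Lemma psmapD f g : psmap (f + g) = psmap f + psmap g.
Proof. by apply/psP => n; rewrite /psmap psDE rmorphD. Qed.

Lemma psmapB f g : psmap (f - g) = psmap f - psmap g.
Proof. by apply/psP => n; rewrite /psmap psBE rmorphB. Qed.

Lemma psmap1 : psmap 1 = 1.
Proof. by apply/psP => n; rewrite /psmap !ps1E rmorph_nat. Qed.

Lemma psmap_inj : injective iota -> injective psmap.
Proof. by move=> inj f g /psP fg; apply/psP => n; apply/inj/fg. Qed.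

End MapSeries.

Lemma psC_shift (S : comPzRingType) (f : ps S) :
  f = psC (f 0%N) + psXn S 1 * psshift 1 f.
Proof.
apply/psP => -[|n]; rewrite psDE psXnME /psC /= ?addr0 //.
by rewrite add0r /psshift subn1 addn1.
Qed.

Lemma psCM (S : comPzRingType) (a b : S) : psC (a * b) = psC a * psC b.
Proof. by apply/psP => n; rewrite psCME /psC; case: eqP; rewrite ?mulr0. Qed.

Lemma invertible_unit (R : idomainType) (x : R) :
  invertible x <-> x \is a GRing.unit.
Proof.
split=> [[y xy]|xU]; last by exists x^-1; rewrite divrr.
by apply/unitrP; exists y; rewrite mulrC.
Qed.

(** With [g = a + X g1] and [h = b + X h1], the equation [f = g h] becomes
    [a h1 + b g1 + X g1 h1 = F]. The coefficient [n] of [X g1 h1] involves only coefficients of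
    index below [n], so the Bezout relation solves the equation degree by degree. *)
Lemma coprime_factorization (R : comPzRingType) (f : ps R) (a b u v : R) :
  f 0%N = a * b -> u * a + v * b = 1 ->
  exists g h, [/\ f = g * h, g 0%N = a & h 0%N = b].
Proof.
move=> f0 uv; pose F := psshift 1 f.
pose fst_ (s : nat -> R * R) : ps R := fun i => (s i).1.
pose snd_ (s : nat -> R * R) : ps R := fun i => (s i).2.
pose cross s := psXn R 1 * (fst_ s * snd_ s).
have cross_ext n s s' : (forall i, (i < n)%N -> s i = s' i) ->
    cross s n = cross s' n.
  move=> ss; rewrite /cross !psXnME; case: ltnP => // lt0n; rewrite !psME.
  apply: eq_bigr => i _; rewrite /fst_ /snd_ !ss //; have := ltn_ord i; lia.
have [n s s' ss' <-|n s|s sP] := @course_of_values (R * R)%type (0, 0)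
  (fun n s => a * (s n).2 + b * (s n).1 + cross s n = F n).
- by rewrite ss' // (cross_ext n s s') // => i /ltnW/ss'.
(* The Bezout relation multiplied by [c] gives [a * (u * c) + b * (v * c) = c]. *)
- pose c := F n - cross s n; exists (v * c, u * c); rewrite eqxx /=.
  rewrite (cross_ext n _ s) => [|i lt_in]; last by rewrite ltn_eqF.
  by rewrite -[RHS](subrK (cross s n)) -/c -[in RHS](mul1r c) -uv; ring.
exists (psC a + psXn R 1 * fst_ s), (psC b + psXn R 1 * snd_ s); split.
- have FE : F = psC a * snd_ s + psC b * fst_ s + cross s.
    by apply/psP => n; rewrite !psDE !psCME sP.
  by rewrite [LHS]psC_shift f0 psCM -/F FE /cross; ring.
- by rewrite psDE psXnME /= addr0.
- by rewrite psDE psXnME /= addr0.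
Qed.

(** * Adically complete rings *)

Section Adic.
Variable A : comPzRingType.
Implicit Types (p x y z g : A) (T : A -> A).

Definition multiple p x := exists y, x = p * y.

Definition separated p := forall x, (forall n, multiple (p ^+ n) x) -> x = 0.

(** Convergence is asked of series in powers of [p]: the Neumann series below has this shape, and
    the property passes to power series coefficientwise. *)
Definition complete p := forall a : nat -> A,
  exists s, forall n, multiple (p ^+ n) (s - \sum_(k < n) p ^+ k * a k).

Lemma multipleD p x y : multiple p x -> multiple p y -> multiple p (x + y).
Proof. by move=> [x' ->] [y' ->]; exists (x' + y'); rewrite mulrDr. Qed.

Lemma multipleN p x : multiple p x -> multiple p (- x).
Proof. by move=> [x' ->]; exists (- x'); rewrite mulrN. Qed.

Lemma multipleMl p x y : multiple p x -> multiple p (x * y).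
Proof. by move=> [x' ->]; exists (x' * y); rewrite mulrA. Qed.

Lemma multipleMr p x y : multiple p y -> multiple p (x * y).
Proof. by rewrite mulrC; apply: multipleMl. Qed.

Lemma multiple_sum p (I : finType) (P : pred I) (F : I -> A) :
  (forall i, P i -> multiple p (F i)) -> multiple p (\sum_(i | P i) F i).
Proof.
move=> pF; elim/big_ind: _ => //; last by move=> *; apply: multipleD.
by exists 0; rewrite mulr0.
Qed.

(* The Neumann series [\sum_k (- p T)^k g]. *)
Lemma contraction_solve p T g : separated p -> complete p ->
    (forall x, T (p * x) = p * T x) -> {morph T : x y / x + y} ->
  exists z, z + p * T z = g.
Proof.
move=> sep compl Tp TD.
pose a k := iter k (fun x => - T x) g.
have [s sP] := compl a; exists s; apply/eqP; rewrite -subr_eq0; apply/eqP/sep => n.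
have [y /eqP] := sP n; rewrite subr_eq => /eqP sE.
have Tpn m x : T (p ^+ m * x) = p ^+ m * T x.
  by elim: m x => [|m IHm] x; rewrite ?mul1r // exprS -!mulrA Tp IHm.
have T0 : T 0 = 0 by apply: (addrI (T 0)); rewrite -TD !addr0.
(* Telescoping: the partial sum solves the equation up to the error [p ^+ m * a m]. *)
have partial m : \sum_(k < m) p ^+ k * a k + p * T (\sum_(k < m) p ^+ k * a k)
    = g - p ^+ m * a m.
  elim: m => [|m IHm]; first by rewrite !big_ord0 T0 mulr0 addr0 mul1r subrr.
  rewrite !big_ord_recr /= TD Tpn mulrDr addrACA IHm exprS; ring.
exists (y + p * T y - a n); rewrite sE TD Tpn.
by have /eqP := partial n; rewrite eq_sym subr_eq => /eqP ->; ring.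
Qed.

Lemma invertible_1Dp p x : separated p -> complete p -> invertible (1 + p * x).
Proof.
move=> sep compl.
have [||z zP] := @contraction_solve p ( *%R x) 1 sep compl.
- by move=> y; rewrite mulrCA.
- by move=> y z; rewrite mulrDr.
- by exists z; rewrite mulrDl mul1r -mulrA.
Qed.

(** When [p] is not invertible, this says that the ring is local with maximal ideal [(p)]. *)
Definition dichotomy p := forall x, multiple p x \/ invertible x.

(** Either [x] is invertible, or a factor [p] of [x] can be cancelled against one of [p ^+ m], since
    [p] is regular. *)
Lemma factor_of_prime_power p m u x y :
    (forall z, p * z = 0 -> z = 0) -> dichotomy p -> invertible u ->
    x * y = u * p ^+ m ->
  exists i v, invertible v /\ x = v * p ^+ i.
Proof.
move=> nzd dich u_inv; elim: m x => [|m IHm] x xy.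
  exists 0%N, x; rewrite mulr1; split=> //.
  by move: u_inv; rewrite -[u]mulr1 -xy => /invertibleM[].
have [[x' x'E]|x_inv] := dich x; last by exists 0%N, x; rewrite mulr1.
have [|i [v [v_inv x'P]]] := IHm x'.
  apply/eqP; rewrite -subr_eq0; apply/eqP/nzd.
  by rewrite mulrBr mulrA -x'E xy exprS; ring.
by exists i.+1, v; rewrite x'E x'P exprS; split=> //; ring.
Qed.

End Adic.

Lemma ps_multiple (A : comPzRingType) (p : A) (f : ps A) :
  multiple (psC p) f <-> forall n, multiple p (f n).
Proof.
split=> [[g ->] n|/choice[g gP]]; first by exists (g n); rewrite psCME.
by exists g; apply/psP => n; rewrite psCME.
Qed.

Lemma ps_separated (A : comPzRingType) (p : A) : separated p -> separated (psC p).
Proof.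
move=> sep f fP; apply/psP => n; apply: sep => k.
by have := fP k; rewrite -psCX ps_multiple.
Qed.

Lemma ps_complete (A : comPzRingType) (p : A) : complete p -> complete (psC p).
Proof.
move=> compl a; have /choice[s sP] := fun n => compl (fun k => a k n).
exists s => n; rewrite -psCX ps_multiple => k; rewrite psBE ps_sumE.
by under eq_bigr => i _ do rewrite -psCX psCME.
Qed.

(** * Weierstrass division and preparation *)

Section Weierstrass.
Variables (S : comPzRingType) (p : S).
Hypotheses (sep : separated p) (compl : complete p) (dich : dichotomy p).

Definition distinguished d (f : ps S) :=
  (forall i, (i < d)%N -> multiple p (f i)) /\ invertible (f d).

Definition is_weierstrass (f : ps S) := exists d,
  [/\ f d = 1, forall i, (d < i)%N -> f i = 0 &
      forall i, (i < d)%N -> multiple p (f i)].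

(** The terms of degree below [d] are collected in [psC p * A]. The rest is [X^d] times a series
    whose constant term [f d] is invertible. *)
Lemma distinguished_split d f : distinguished d f ->
  exists A W W', f = psC p * A + psXn S d * W /\ W * W' = 1.
Proof.
move=> [low fd].
have /choice[A AP] : forall i, exists a, if (i < d)%N then f i = p * a else a = 0.
  by move=> i; case: ltnP => [/low[a]|_]; [exists a|exists 0].
have [W' WW'] : invertible (psshift d f) by apply/ps_invertible; rewrite /psshift add0n.
exists A, (psshift d f), W'; split=> //; apply/psP => i.
rewrite psDE psCME psXnME /psshift; have := AP i.
by case: ltnP => [_ <-|le_di ->]; rewrite ?addr0 // mulr0 add0r subnK.
Qed.

(** Write [f = p A + X^d W] with [W] a unit and look for [q = z / W]. Then
    [q f = p (z A / W) + X^d z], and comparing the coefficients from degree [d] on gives an equation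
    [z + p T z = psshift d g] of Neumann type. *)
Lemma weierstrass_division d f g : distinguished d f ->
  exists q, forall i, (d <= i)%N -> (g - q * f) i = 0.
Proof.
move=> /distinguished_split[A [W [W' [fE WW']]]].
have [||||z zP] := @contraction_solve _ (psC p)
  (fun z => psshift d (z * W' * A)) (psshift d g).
- exact: ps_separated.
- exact: ps_complete.
- by move=> x; rewrite -!mulrA psshiftC.
- by move=> x y; rewrite !mulrDl psshiftD.
exists (z * W') => i le_di; rewrite -(subnK le_di).
suff : psshift d (g - z * W' * f) = 0 by move/psP/(_ (i - d)%N).
have -> : z * W' * f = psC p * (z * W' * A) + psXn S d * z.
  transitivity (psC p * (z * W' * A) + psXn S d * z * (W * W')).
    by rewrite fE; ring.
  by rewrite WW' mulr1.
apply/psP => k; move/psP/(_ k): zP; rewrite /psshift !psBE !psDE => <-.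
by rewrite -[X in _ - (_ + X)]/(psshift d _ k) psshiftXn !psCME ps0E; ring.
Qed.

Lemma distinguished_exists f : (exists i, ~ multiple p (f i)) ->
  exists d, distinguished d f.
Proof.
move=> [i fi].
have ex : exists n, `[< ~ multiple p (f n) >] by exists i; apply/asboolP.
case: (ex_minnP ex) => d /asboolP fd dmin; exists d; split.
  move=> j lt_jd; apply: contrapT => fj.
  by have := dmin j; rewrite asboolT // leqNgt lt_jd => /(_ isT).
by case: (dich (f d)).
Qed.

(** Dividing [X^d] by [f] gives [q] such that [q f] is monic of degree [d]; its lower coefficients
    are multiples of [p] because those of [f] are. The coefficient of degree [d] reads
    [1 = q 0 * f d + p z], and [1 - p z] is invertible, hence so is [q]. *)
Lemma weierstrass_preparation f : (exists i, ~ multiple p (f i)) ->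
  exists U P, [/\ invertible U, is_weierstrass P & f = U * P].
Proof.
move=> /distinguished_exists[d fd].
have [q qP] := weierstrass_division (psXn S d) fd.
have low i : (i < d)%N -> multiple p ((q * f) i).
  move=> lt_id; apply: multiple_sum => j _; apply: multipleMr.
  by apply: fd.1; apply: leq_ltn_trans lt_id; apply: leq_subr.
have high i : (d <= i)%N -> (q * f) i = (i == d)%:R.
  by move/qP/eqP; rewrite psBE subr_eq0 => /eqP <-.
have [q' qq'] : invertible q.
  apply/ps_invertible.
  have : (q * f) d = 1 by rewrite high ?eqxx.
  rewrite psME big_ord_recl /= subn0.
  have [z ->] : multiple p (\sum_(i < d) q (bump 0 i) * f (d - bump 0 i)%N).
    apply: multiple_sum => j _; apply: multipleMr; apply: fd.1.
    by rewrite /bump; have := ltn_ord j; lia.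
  move=> qfE; have := invertible_1Dp (- z) sep compl.
  by rewrite mulrN -qfE addrK => /invertibleM[].
exists q', (q * f); split; first by exists q; rewrite mulrC.
  exists d; split=> [|i lt_di|//]; first by rewrite high ?eqxx.
  by rewrite high ?gtn_eqF // ltnW.
by rewrite mulrA [q' * q]mulrC qq' mul1r.
Qed.

Lemma is_weierstrass_poly P : is_weierstrass P -> is_poly P.
Proof. by move=> [d [_ high _]]; exists d.+1. Qed.

Lemma is_weierstrass_distinguished P :
  is_weierstrass P -> exists d, distinguished d P.
Proof.
by move=> [d [Pd _ low]]; exists d; split=> //; rewrite Pd; apply: invertible1.
Qed.

(* The equation for the coefficient [k + d] of [P * s] shows that the high
   coefficients of [s] are [p] times combinations of higher ones. *)
Lemma weierstrass_quotient_poly P s :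
  is_weierstrass P -> is_poly (P * s) -> is_poly s.
Proof.
move=> [d [Pd high low]] [N PsN]; exists N => k le_Nk; apply: sep => n.
(* The divisibility of [s k] by [p ^+ n] is proved for all [k >= N] at once, because the induction
   step refers to larger indices. *)
elim: n k le_Nk => [|n IHn] k le_Nk; first by exists (s k); rewrite mul1r.
have := PsN (k + d)%N (leq_trans le_Nk (leq_addr _ _)).
have lt_d : (d < (k + d).+1)%N by lia.
rewrite psME (bigD1 (Ordinal lt_d)) //= Pd mul1r addnK => /eqP.
rewrite addr_eq0 => /eqP ->; apply/multipleN/multiple_sum => i ne_id.
have [lt_id|lt_di|eq_id] := ltngtP i d.
- have [y ->] := low _ lt_id; have [|z ->] := IHn (k + d - i)%N; first by lia.
  by exists (y * z); rewrite exprS; ring.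
- by rewrite high // mul0r; exists 0; rewrite mulr0.
- by case/eqP: ne_id; apply: val_inj.
Qed.

End Weierstrass.

(** * The completion as a ring *)

Lemma dvdRE (R : idomainType) (a b : R) : dvdR a b <-> multiple a b.
Proof. by split=> -[c ->]; exists c; rewrite mulrC. Qed.

Section CauchySequences.
Variables (R : idomainType) (pi : R).
Implicit Types c d e : compl R.

Lemma multipleX_le (x : R) m n :
  (m <= n)%N -> multiple (pi ^+ n) x -> multiple (pi ^+ m) x.
Proof.
by move=> /subnK <- [y ->]; exists (pi ^+ (n - m) * y); rewrite exprD; ring.
Qed.

Lemma cauchyP c : cauchy pi c <-> forall n, multiple (pi ^+ n) (c n.+1 - c n).
Proof. by split=> cP n; apply/dvdRE/cP. Qed.

Lemma ceqP c d : ceq pi c d <-> forall n, multiple (pi ^+ n) (c n - d n).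
Proof. by split=> cP n; apply/dvdRE/cP. Qed.

Lemma cauchy_diff c n k : cauchy pi c -> multiple (pi ^+ n) (c (n + k)%N - c n).
Proof.
move/cauchyP=> cP; elim: k => [|k IHk].
  by rewrite addn0 subrr; exists 0; rewrite mulr0.
rewrite addnS -(subrKA (c (n + k)%N)); apply: multipleD => //.
by apply: multipleX_le (cP _); apply: leq_addr.
Qed.

Lemma cauchy_const r : cauchy pi (cconst r).
Proof. by apply/cauchyP => n; rewrite subrr; exists 0; rewrite mulr0. Qed.

Lemma cauchyD c d : cauchy pi c -> cauchy pi d -> cauchy pi (fun n => c n + d n).
Proof.
move=> /cauchyP cP /cauchyP dP; apply/cauchyP => n.
by rewrite opprD addrACA; apply: multipleD.
Qed.

Lemma cauchyN c : cauchy pi c -> cauchy pi (fun n => - c n).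
Proof. by move=> /cauchyP cP; apply/cauchyP => n; rewrite -opprD; apply: multipleN. Qed.

Lemma multipleM_sub (a x y x' y' : R) :
  multiple a (x - x') -> multiple a (y - y') -> multiple a (x * y - x' * y').
Proof.
move=> xP yP; have -> : x * y - x' * y' = (x - x') * y + x' * (y - y') by ring.
by apply: multipleD; [apply: multipleMl|apply: multipleMr].
Qed.

Lemma cauchyM c d : cauchy pi c -> cauchy pi d -> cauchy pi (fun n => c n * d n).
Proof.
by move=> /cauchyP cP /cauchyP dP; apply/cauchyP => n; apply: multipleM_sub.
Qed.

Lemma cauchy_sum n (F : 'I_n -> compl R) :
  (forall i, cauchy pi (F i)) -> cauchy pi (fun k => \sum_(i < n) F i k).
Proof.
move=> FP; apply/cauchyP => k; rewrite -sumrB.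
by apply: multiple_sum => i _; have /cauchyP := FP i; apply.
Qed.

Lemma ceq_refl c : ceq pi c c.
Proof. by apply/ceqP => n; rewrite subrr; exists 0; rewrite mulr0. Qed.

Lemma ceq_sym c d : ceq pi c d -> ceq pi d c.
Proof. by move=> /ceqP cd; apply/ceqP => n; rewrite -opprB; apply: multipleN. Qed.

Lemma ceq_trans d c e : ceq pi c d -> ceq pi d e -> ceq pi c e.
Proof.
move=> /ceqP cd /ceqP de; apply/ceqP => n.
by rewrite -(subrKA (d n)); apply: multipleD.
Qed.

Lemma ceqD c d c' d' : ceq pi c c' -> ceq pi d d' ->
  ceq pi (fun n => c n + d n) (fun n => c' n + d' n).
Proof.
move=> /ceqP cc /ceqP dd; apply/ceqP => n.
by rewrite opprD addrACA; apply: multipleD.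
Qed.

Lemma ceqN c c' : ceq pi c c' -> ceq pi (fun n => - c n) (fun n => - c' n).
Proof. by move=> /ceqP cc; apply/ceqP => n; rewrite -opprD; apply: multipleN. Qed.

Lemma ceqM c d c' d' : ceq pi c c' -> ceq pi d d' ->
  ceq pi (fun n => c n * d n) (fun n => c' n * d' n).
Proof. by move=> /ceqP cc /ceqP dd; apply/ceqP => n; apply: multipleM_sub. Qed.

End CauchySequences.

Section CompletionRing.
Variables (R : idomainType) (pi : R).
Implicit Types c d : compl R.

(** An element is a whole class of [ceq], as a predicate. Extensionality then makes equality of
    elements coincide with [ceq] of representatives, and the ring axioms hold as plain
    equalities. *)
Definition completion :=
  {A : compl R -> Prop | exists2 c, cauchy pi c & A = ceq pi c}.

HB.instance Definition _ := gen_eqMixin completion.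
HB.instance Definition _ := gen_choiceMixin completion.

Definition crepr (x : completion) : compl R := s2val (cid2 (proj2_sig x)).

(* The class of [0] when [c] is not a compatible system. *)
Definition cclass c : completion :=
  match pselect (cauchy pi c) with
  | left cP => exist _ (ceq pi c) (ex_intro2 _ _ c cP erefl)
  | right _ => exist _ (ceq pi (cconst 0))
                 (ex_intro2 _ _ (cconst 0) (cauchy_const pi 0) erefl)
  end.

Lemma crepr_cauchy x : cauchy pi (crepr x).
Proof. exact: (s2valP (cid2 (proj2_sig x))). Qed.
Hint Resolve crepr_cauchy : core.

Lemma completion_inj (x y : completion) : proj1_sig x = proj1_sig y -> x = y.
Proof.
by case: x y => [A AP] [B BP] /= AB; subst B; congr exist; apply: Prop_irrelevance.
Qed.

Lemma proj1_cclass c : cauchy pi c -> proj1_sig (cclass c) = ceq pi c.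
Proof. by rewrite /cclass; case: pselect. Qed.

Lemma creprK x : cclass (crepr x) = x.
Proof.
apply: completion_inj; rewrite proj1_cclass //.
by rewrite -(s2valP' (cid2 (proj2_sig x))).
Qed.

Lemma cclass_eq c d : cauchy pi c -> cauchy pi d ->
  cclass c = cclass d <-> ceq pi c d.
Proof.
move=> cP dP; split=> [/(congr1 (@proj1_sig _ _))|cd].
  by rewrite !proj1_cclass // => /funeqP/(_ d) ->; apply: ceq_refl.
apply: completion_inj; rewrite !proj1_cclass //; apply/funext => e.
apply/propext; split; last exact: ceq_trans.
by apply: ceq_trans; apply: ceq_sym.
Qed.

Lemma crepr_class c : cauchy pi c -> ceq pi (crepr (cclass c)) c.
Proof. by move=> cP; apply/cclass_eq => //; rewrite creprK. Qed.

Let zero := cclass (cconst 0).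
Let one := cclass (cconst 1).
Let add x y := cclass (fun n => crepr x n + crepr y n).
Let opp x := cclass (fun n => - crepr x n).
Let mul x y := cclass (fun n => crepr x n * crepr y n).

Let addE c d : cauchy pi c -> cauchy pi d ->
  add (cclass c) (cclass d) = cclass (fun n => c n + d n).
Proof.
by move=> cP dP; apply/cclass_eq; rewrite ?crepr_class; [exact: cauchyD..|];
  apply: ceqD; apply: crepr_class.
Qed.

Let oppE c : cauchy pi c -> opp (cclass c) = cclass (fun n => - c n).
Proof.
by move=> cP; apply/cclass_eq; [exact: cauchyN..|];
  apply: ceqN; apply: crepr_class.
Qed.

Let mulE c d : cauchy pi c -> cauchy pi d ->
  mul (cclass c) (cclass d) = cclass (fun n => c n * d n).
Proof.
by move=> cP dP; apply/cclass_eq; [exact: cauchyM..|];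
  apply: ceqM; apply: crepr_class.
Qed.

Lemma completionP (x : completion) : exists2 c, cauchy pi c & x = cclass c.
Proof. by exists (crepr x); rewrite ?creprK. Qed.

Let addA : associative add.
Proof.
move=> x y z; have [c cP ->] := completionP x; have [d dP ->] := completionP y.
have [e eP ->] := completionP z; rewrite !addE //; try exact: cauchyD.
by congr cclass; apply/funext => n; rewrite addrA.
Qed.
Let addC : commutative add.
Proof.
move=> x y; have [c cP ->] := completionP x; have [d dP ->] := completionP y.
by rewrite !addE //; congr cclass; apply/funext => n; rewrite addrC.
Qed.
Let add0 : left_id zero add.
Proof.
move=> x; have [c cP ->] := completionP x.
rewrite addE //; last exact: cauchy_const.
by congr cclass; apply/funext => n; rewrite add0r.
Qed.
Let addN : left_inverse zero opp add.
Proof.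
move=> x; have [c cP ->] := completionP x.
rewrite oppE ?addE //; last exact: cauchyN.
by congr cclass; apply/funext => n; rewrite addNr.
Qed.

HB.instance Definition _ := GRing.isZmodule.Build completion addA addC add0 addN.

Let mulA : associative mul.
Proof.
move=> x y z; have [c cP ->] := completionP x; have [d dP ->] := completionP y.
have [e eP ->] := completionP z; rewrite !mulE //; try exact: cauchyM.
by congr cclass; apply/funext => n; rewrite mulrA.
Qed.
Let mulC : commutative mul.
Proof.
move=> x y; have [c cP ->] := completionP x; have [d dP ->] := completionP y.
by rewrite !mulE //; congr cclass; apply/funext => n; rewrite mulrC.
Qed.
Let mul1 : left_id one mul.
Proof.
move=> x; have [c cP ->] := completionP x.
rewrite mulE //; last exact: cauchy_const.
by congr cclass; apply/funext => n; rewrite mul1r.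
Qed.
Let mulD : left_distributive mul add.
Proof.
move=> x y z; have [c cP ->] := completionP x; have [d dP ->] := completionP y.
have [e eP ->] := completionP z.
rewrite addE // !mulE //; last exact: cauchyD.
rewrite addE; try exact: cauchyM.
by congr cclass; apply/funext => n; rewrite mulrDl.
Qed.

HB.instance Definition _ := GRing.Zmodule_isComPzRing.Build completion
  mulA mulC mul1 mulD.

Lemma cclassD c d : cauchy pi c -> cauchy pi d ->
  cclass (fun n => c n + d n) = cclass c + cclass d.
Proof. by move=> cP dP; rewrite -addE. Qed.

Lemma cclassN c : cauchy pi c -> cclass (fun n => - c n) = - cclass c.
Proof. by move=> cP; rewrite -oppE. Qed.

Lemma cclassB c d : cauchy pi c -> cauchy pi d ->
  cclass (fun n => c n - d n) = cclass c - cclass d.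
Proof. by move=> cP dP; rewrite cclassD ?cclassN //; apply: cauchyN. Qed.

Lemma cclassM c d : cauchy pi c -> cauchy pi d ->
  cclass (fun n => c n * d n) = cclass c * cclass d.
Proof. by move=> cP dP; rewrite -mulE. Qed.

Lemma cclass_sum n (F : 'I_n -> compl R) : (forall i, cauchy pi (F i)) ->
  cclass (fun k => \sum_(i < n) F i k) = \sum_(i < n) cclass (F i).
Proof.
elim: n F => [|n IHn] F FP.
  by rewrite big_ord0; congr cclass; apply/funext => k; rewrite big_ord0.
rewrite big_ord_recr -IHn //= -cclassD //; last by apply: cauchy_sum.
by congr cclass; apply/funext => k; rewrite big_ord_recr.
Qed.

Definition cinj (r : R) : completion := cclass (cconst r).

Let cinj_zmod_morphism : zmod_morphism cinj.
Proof. by move=> r s; rewrite /cinj -cclassB //; apply: cauchy_const. Qed.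
Let cinj_monoid_morphism : monoid_morphism cinj.
Proof. by split=> // r s; rewrite /cinj -cclassM //; apply: cauchy_const. Qed.

HB.instance Definition _ :=
  GRing.isZmodMorphism.Build R completion cinj cinj_zmod_morphism.
HB.instance Definition _ :=
  GRing.isMonoidMorphism.Build R completion cinj cinj_monoid_morphism.

Local Notation p := (cinj pi).

Lemma cinjX_M n c : cauchy pi c -> p ^+ n * cclass c = cclass (fun k => pi ^+ n * c k).
Proof. by move=> cP; rewrite -rmorphXn -cclassM //; apply: cauchy_const. Qed.

Lemma cauchyZ r c : cauchy pi c -> cauchy pi (fun k => r * c k).
Proof. by move=> cP; apply: (cauchyM (c := cconst r)) => //; apply: cauchy_const. Qed.

(** Equality in the completion is read at level [n], where [c n] and [pi ^+ n * d n] agree modulo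
    [pi ^+ n]. *)
Lemma completion_multiple n c : cauchy pi c ->
  multiple (p ^+ n) (cclass c) -> multiple (pi ^+ n) (c n).
Proof.
move=> cP [x]; have [d dP ->] := completionP x.
rewrite cinjX_M // => /cclass_eq/ceqP cd.
have {}cd := cd cP (cauchyZ _ dP) n.
by rewrite -(subrK (pi ^+ n * d n) (c n)); apply: multipleD => //; exists (d n).
Qed.

Lemma cinj_multiple n r : multiple (p ^+ n) (cinj r) -> multiple (pi ^+ n) r.
Proof. by move/completion_multiple; apply; apply: cauchy_const. Qed.

Lemma completion_separated : separated p.
Proof.
move=> x; have [c cP ->] := completionP x => xP.
apply/cclass_eq => //; first exact: cauchy_const.
by apply/ceqP => n; rewrite subr0; apply: completion_multiple.
Qed.

Lemma completion_complete : complete p.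
Proof.
move=> a; pose c k := crepr (a k).
have cP k : cauchy pi (c k) by apply: crepr_cauchy.
(* The tail of the series from index [m] on, divided by [pi ^+ m]. The case [m = 0] represents the
   limit, the case [m = n] the quotient of the [n]th error by [p ^+ n]. *)
have shiftP m : cauchy pi (fun n => \sum_(k < n) pi ^+ k * c (m + k)%N n).
  apply/cauchyP => n; rewrite big_ord_recr /= addrAC -sumrB.
  apply: multipleD; last by apply: multipleMl; exists 1; rewrite mulr1.
  apply: multiple_sum => k _; rewrite -mulrBr; apply: multipleMr.
  by have /cauchyP := cP (m + k)%N; apply.
exists (cclass (fun n => \sum_(k < n) pi ^+ k * c k n)) => n.
exists (cclass (fun m => \sum_(k < m) pi ^+ k * c (n + k)%N m)).
have -> : \sum_(k < n) p ^+ k * a k = cclass (fun m => \sum_(k < n) pi ^+ k * c k m).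
  rewrite cclass_sum => [|k]; last exact: cauchyZ.
  by apply: eq_bigr => k _; rewrite -cinjX_M // /c creprK.
have sumP : cauchy pi (fun m => \sum_(k < n) pi ^+ k * c k m).
  by apply: cauchy_sum => k; apply: cauchyZ.
have shift0P := shiftP 0%N.
rewrite cinjX_M // -cclassB //; apply/cclass_eq.
- by apply: cauchyD => //; apply: cauchyN.
- exact: cauchyZ.
apply/ceqP => m; rewrite -addrA -opprD big_distrr /=.
have -> : \sum_(k < n) pi ^+ k * c k m +
    \sum_(i < m) pi ^+ n * (pi ^+ i * c (n + i)%N m) =
    \sum_(k < n + m) pi ^+ k * c k m.
  rewrite big_split_ord; congr (_ + _).
  by apply: eq_bigr => k _; rewrite /= exprD mulrA.
(* At level [m], the difference consists of the terms of index at least [m], all multiples of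
   [pi ^+ m]. *)
rewrite addnC big_split_ord /= opprD addrA subrr sub0r.
apply/multipleN/multiple_sum => k _.
by exists (pi ^+ k * c (m + k)%N m); rewrite exprD mulrA.
Qed.

Hypothesis pi_neq0 : pi != 0.

(** Cancelling [pi] costs one level: [pi ^+ n.+1] divides [pi * c n.+1], so [pi ^+ n] divides
    [c n.+1], which is congruent to [c n] modulo [pi ^+ n]. *)
Lemma completion_regular x : p * x = 0 -> x = 0.
Proof.
have [c cP ->] := completionP x.
rewrite -[p]expr1 cinjX_M // => /cclass_eq/ceqP xP.
have {}xP := xP (cauchyZ _ cP) (cauchy_const _ _).
apply/cclass_eq => //; first exact: cauchy_const.
apply/ceqP => n; rewrite subr0.
have [y] := xP n.+1; rewrite subr0 expr1 exprS -mulrA => /(mulfI pi_neq0) yE.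
rewrite -[c n](subKr (c n.+1)) yE; apply: multipleD; first by exists y.
by apply/multipleN; rewrite -yE; have /cauchyP := cP; apply.
Qed.

Lemma completion_regularX n x : p ^+ n * x = 0 -> x = 0.
Proof.
elim: n x => [|n IHn] x; first by rewrite mul1r.
by rewrite exprS -mulrA => /completion_regular/IHn.
Qed.

(** The approximation is [c n]. The quotients of [c (n + k) - c n] by [pi ^+ n] again form a
    compatible system, which represents the cofactor. *)
Lemma completion_dense n x : exists r, multiple (p ^+ n) (x - cinj r).
Proof.
have [c cP ->] := completionP x; exists (c n).
have /choice[y yP] k := cauchy_diff n k cP.
have pin_neq0 : pi ^+ n != 0 by rewrite expf_neq0.
have y_cauchy : cauchy pi y.
  apply/cauchyP => k.
  have /cauchyP/(_ (n + k)%N)[z zE] := cP.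
  exists z; apply: (mulfI pin_neq0).
  by rewrite mulrBr -!yP mulrA -exprD -zE addnS; ring.
exists (cclass y); rewrite cinjX_M // -cclassB //; last exact: cauchy_const.
apply/cclass_eq; last 1 first.
- apply/ceqP => k; rewrite -yP /cconst addnC.
  have -> : c k - c n - (c (k + n)%N - c n) = - (c (k + n)%N - c k) by ring.
  exact/multipleN/cauchy_diff.
- by apply: cauchyD => //; apply: cauchyN; apply: cauchy_const.
- exact: cauchyZ.
Qed.

Lemma cinj_inj (x y : R) :
  (forall r, (forall n, multiple (pi ^+ n) r) -> r = 0) -> cinj x = cinj y -> x = y.
Proof.
move=> sepR xy; apply/eqP; rewrite -subr_eq0; apply/eqP/sepR => n.
by apply: cinj_multiple; rewrite rmorphB /= xy subrr; exists 0; rewrite mulr0.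
Qed.

End CompletionRing.

(** * Divisibility in a principal ideal domain *)

Section PID.
Variable R : idomainType.
Hypothesis pid : is_PID R.
Implicit Types a b c x pi : R.

Lemma multiple_trans (y x z : R) : multiple x y -> multiple y z -> multiple x z.
Proof. by move=> [y' ->] [z' ->]; exists (y' * z'); rewrite mulrA. Qed.

Lemma multiple_refl x : multiple x x.
Proof. by exists 1; rewrite mulr1. Qed.

Lemma prime_not_multiple1 pi : prime_elt pi -> ~ multiple pi 1.
Proof.
by move=> [_ [piN _]] [x x1]; case/negP: piN; apply/invertible_unit; exists x.
Qed.

Lemma bezout_gcd a b : exists d u v,
  [/\ multiple d a, multiple d b & d = u * a + v * b].
Proof.
have [|d dP] := pid (I := fun x => exists u v, x = u * a + v * b).
  split; first by exists 0, 0; rewrite !mul0r addr0.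
  split=> [x y [u [v ->]] [u' [v' ->]]|r x [u [v ->]]].
    by exists (u + u'), (v + v'); ring.
  by exists (r * u), (r * v); ring.
have [u [v dE]] : exists u v, d = u * a + v * b.
  by apply/dP; exists 1; rewrite mul1r.
exists d, u, v; split=> //; apply/dvdRE/dP.
  by exists 1, 0; rewrite mul1r mul0r addr0.
by exists 0, 1; rewrite mul1r mul0r add0r.
Qed.

(** Let [d] generate the ideal of [x] and [a], with [x = d e]. If [d] is a unit, a Bezout relation
    shows that [x] divides [b]; if [e] is a unit, [x] divides [d] and hence [a]. *)
Lemma irreducible_prime x : x != 0 -> x \isn't a GRing.unit ->
  (forall y z, x = y * z -> invertible y \/ invertible z) -> prime_elt x.
Proof.
move=> x0 xN irr; split=> //; split=> // a b /dvdRE[c abE].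
have [d [u [v [[e xE] [e' aE] dE]]]] := bezout_gcd x a.
have [[d' dd']|[y ey]] := irr _ _ xE; [right|left]; apply/dvdRE.
  exists (d' * (u * b + v * c)).
  transitivity ((d * d') * b); first by rewrite dd' mul1r.
  have -> : x * (d' * (u * b + v * c)) = d' * (u * x * b + v * (x * c)) by ring.
  by rewrite -abE dE; ring.
exists (y * e'); rewrite aE xE; transitivity (d * e' * (e * y)); last by ring.
by rewrite ey mulr1.
Qed.

(** Without a prime divisor, every nonunit divisor of [a] would have a proper nonunit divisor.
    Iterating gives a strictly ascending chain of principal ideals; their union is principal, so the
    chain stops, a contradiction. *)
Lemma prime_divisor a : a != 0 -> a \isn't a GRing.unit ->
  exists pi, prime_elt pi /\ multiple pi a.
Proof.
move=> a0 aN; apply: contrapT => nopi.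
pose D x := [/\ multiple x a, x != 0 & x \isn't a GRing.unit].
have /choice[F FP] : forall x, exists y, D x -> [/\ D y, multiple y x & ~ multiple x y].
  move=> x; have [[xa x0 xN]|nDx] := pselect (D x); last by exists 0.
  suff [y [z [xE yN zN]]] : exists y z,
      [/\ x = y * z, ~ invertible y & ~ invertible z].
    have [y0 z0] : y != 0 /\ z != 0 by apply/andP; rewrite -negb_or -mulf_eq0 -xE.
    exists y => _; split; last 1 first.
    - rewrite xE => -[w]; rewrite -mulrA => yE; apply: zN; exists w.
      by apply: (mulfI y0); rewrite mulr1 -yE.
    - split=> //; last by apply/negP => /invertible_unit.
      by apply: multiple_trans xa; exists z.
    - by exists z.
  apply: contrapT => noyz; apply: nopi; exists x; split=> //.
  apply: irreducible_prime => // y z xE.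
  by apply: contrapT => /not_orP[yN zN]; apply: noyz; exists y, z.
pose s n := iter n F a.
have sD n : D (s n).
  by elim: n => [|n /FP[]//]; split=> //; apply: multiple_refl.
have chain n k : multiple (s (n + k)%N) (s n).
  elim: k => [|k IHk]; first by rewrite addn0; apply: multiple_refl.
  by apply: multiple_trans IHk; rewrite addnS; have [] := FP _ (sD (n + k)%N).
(* A generator [b] of the union is a multiple of some [s n], and [b] divides [s n.+1]; so [s n]
   divides [s n.+1], which the choice of [F] excludes. *)
have [|b bP] := pid (I := fun x => exists n, multiple (s n) x).
  split; first by exists 0%N, 0; rewrite mulr0.
  split=> [x y [m xP] [n yP]|r x [n xP]]; last by exists n; apply: multipleMr.
  exists (m + n)%N; apply: multipleD.
    by apply: multiple_trans xP; apply: chain.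
  by apply: multiple_trans yP; rewrite addnC; apply: chain.
have [n nP] : exists n, multiple (s n) b by apply/bP; exists 1; rewrite mul1r.
have [_ _] := FP _ (sD n); apply; apply: multiple_trans nP _.
by apply/dvdRE/bP; exists n.+1; apply: multiple_refl.
Qed.

Section Prime.
Variable pi : R.
Hypothesis piP : prime_elt pi.

Let pi_neq0 : pi != 0. Proof. by case: piP. Qed.

Lemma bezout_prime c : ~ multiple pi c -> exists a b, a * c + b * pi = 1.
Proof.
move=> pic; have [d [u [v [dc [e piE] dE]]]] := bezout_gcd c pi.
have [_ [_ pi_prime]] := piP.
have [|/dvdRE pi_d|/dvdRE[e' eE]] := pi_prime d e.
- by exists 1; rewrite mul1r.
- by case: pic; apply: multiple_trans pi_d dc.
suff de' : d * e' = 1.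
  by exists (e' * u), (e' * v); rewrite -!mulrA -mulrDr -dE mulrC.
by apply: (mulfI pi_neq0); rewrite mulr1 mulrCA -eE -piE.
Qed.

Lemma bezout_primeX n c : ~ multiple pi c -> exists a b, a * c + b * pi ^+ n = 1.
Proof.
move=> pic; elim: n => [|n [a [b abE]]].
  by exists 0, 1; rewrite mul0r add0r mul1r.
have [a' [b' abE']] := bezout_prime pic.
exists (a * (a' * c + b' * pi) + b * pi ^+ n * a'), (b * b').
transitivity ((a * c + b * pi ^+ n) * (a' * c + b' * pi)).
  by rewrite exprS; ring.
by rewrite abE abE' mulr1.
Qed.

(** Let [b] generate the ideal of all [x] such that [a] divides some [x * pi ^+ k], and take [k] for
    [x = b]. If [a = pi ^+ k.+1 * y], then [y] lies in this ideal, so [b] divides [y]; cancelling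
    [b * pi ^+ k] makes [pi] a unit. *)
Lemma prime_powers_separated a : a != 0 -> exists n, ~ multiple (pi ^+ n) a.
Proof.
move=> a0; have [|b bP] := pid (I := fun x => exists k, multiple a (x * pi ^+ k)).
  split; first by exists 0%N, 0; rewrite mul0r mulr0.
  split=> [x y [m xP] [n yP]|r x [n xP]]; last first.
    by exists n; rewrite -mulrA; apply: multipleMr.
  exists (m + n)%N; rewrite mulrDl exprD; apply: multipleD.
    by rewrite mulrA; apply: multipleMl.
  by rewrite mulrCA; apply: multipleMr.
have [k [e eE]] : exists k, multiple a (b * pi ^+ k).
  by apply/bP; exists 1; rewrite mul1r.
exists k.+1 => -[y yE].
have [c cE] : dvdR b y by apply/bP; exists k.+1, 1; rewrite mulr1 yE mulrC.
apply: (prime_not_multiple1 piP); exists (c * e).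
have b0 : b != 0.
  by apply: contraNneq a0 => b0; rewrite yE cE b0 !mulr0.
apply: (mulfI (mulf_neq0 b0 (expf_neq0 k pi_neq0))).
by rewrite mulr1 [LHS]eE yE cE exprS; ring.
Qed.

Lemma prime_separated x : (forall n, multiple (pi ^+ n) x) -> x = 0.
Proof.
move=> xP; apply/eqP; apply: contrapT => /negP x0.
by have [n] := prime_powers_separated x0; apply.
Qed.

Lemma prime_power_part a : a != 0 ->
  exists m c, a = pi ^+ m * c /\ ~ multiple pi c.
Proof.
move=> a0; have [n nP] := prime_powers_separated a0.
have ex : exists n, `[< ~ multiple (pi ^+ n) a >] by exists n; apply/asboolP.
case: (ex_minnP ex) => -[|m] /asboolP mP mmin.
  by case: mP; exists a; rewrite mul1r.
have [c aE] : multiple (pi ^+ m) a.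
  apply: contrapT => mN; have := mmin m; rewrite asboolT //.
  by rewrite ltnn => /(_ isT).
exists m, c; split=> // -[c' cE]; apply: mP.
by exists c'; rewrite aE cE exprS; ring.
Qed.

(** In a Bezout relation between [x] and [pi ^+ m], the power is itself a multiple of [x]. *)
Lemma prime_power_cofactor_unit m u x y : u \is a GRing.unit ->
  x * y = u * pi ^+ m -> ~ multiple pi x -> x \is a GRing.unit.
Proof.
move=> uU xy pix; have [a [b ab1]] := bezout_primeX m pix.
apply/invertible_unit; exists (a + b * (u^-1 * y)).
by rewrite -ab1 -[in RHS](mulKr uU (pi ^+ m)) -xy; ring.
Qed.

(** * Comparison of power series over the ring and over its completion *)

Local Notation p := (cinj pi pi).
Local Notation iota := (psmap (cinj pi)).

(** Modulo [p], [x] is some [r] in [R]. If [pi] does not divide [r], a Bezout relation gives a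
    multiple of [x] of the form [1 + p z], which is invertible by completeness. *)
Lemma completion_dichotomy : dichotomy p.
Proof.
move=> x; have [r [y /eqP]] := completion_dense pi_neq0 1 x.
rewrite subr_eq expr1 => /eqP xE.
have [[z rE]|pir] := pselect (multiple pi r); [left|right].
  by exists (y + cinj pi z); rewrite xE rE rmorphM /= -mulrDr.
have [a [b ab1]] := bezout_prime pir.
have := invertible_1Dp (cinj pi a * y - cinj pi b)
  (@completion_separated _ pi) (@completion_complete _ pi).
suff -> : 1 + p * (cinj pi a * y - cinj pi b) = cinj pi a * x.
  by case/invertibleM.
rewrite xE -(rmorph1 (cinj pi)) -ab1 rmorphD !rmorphM /=; ring.
Qed.

Lemma iota_inj : injective iota.
Proof. by apply: psmap_inj => x y; apply: cinj_inj prime_separated. Qed.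

Lemma completion_p_not_invertible : ~ multiple p 1.
Proof.
rewrite -(rmorph1 (cinj pi)) -[p]expr1 => /cinj_multiple.
by rewrite expr1; apply: prime_not_multiple1.
Qed.

(** By induction on [i], [E i * u * pi ^+ n] equals an element [t] of [R]. Divisibility of [t] by
    [pi ^+ n] descends from the completion to [R], so both [pi ^+ n] and [u] can be divided out in
    [R]. *)
Lemma series_descent (f k : ps R) (E : ps (completion pi)) u n : u \is a GRing.unit ->
  k 0%N = u * pi ^+ n -> iota f = E * iota k ->
  exists e : ps R, E = iota e.
Proof.
move=> uU k0 fE; pose im (x : completion pi) := exists r, x = cinj pi r.
suff /choice[e eP] : forall i, im (E i) by exists e; apply/psP.
elim/ltn_ind => i IHi.
have : im (cinj pi (f i) - \sum_(j < i) E j * iota k (i - j)%N).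
  have [r ->] : im (\sum_(j < i) E j * iota k (i - j)%N).
    elim/big_ind: _ => [|_ _ [x ->] [y ->]|j _].
    - by exists 0; rewrite rmorph0.
    - by exists (x + y); rewrite rmorphD.
    - have [r ->] := IHi j (ltn_ord j).
      by exists (r * k (i - j)%N); rewrite rmorphM.
  by exists (f i - r); rewrite rmorphB.
have -> : cinj pi (f i) = (E * iota k) i by rewrite -fE.
rewrite psME big_ord_recr /= addrAC subrr add0r subnn => -[t].
rewrite k0 rmorphM rmorphXn /= => tE.
have [t' t'E] : multiple (pi ^+ n) t.
  by apply: cinj_multiple; rewrite -tE; exists (E i * cinj pi u); ring.
have EuE : E i * cinj pi u = cinj pi t'.
  apply/eqP; rewrite -subr_eq0; apply/eqP/(completion_regularX pi_neq0 (n := n)).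
  rewrite mulrBr; have -> : p ^+ n * cinj pi t' = cinj pi t.
    by rewrite t'E rmorphM rmorphXn.
  by rewrite -tE; ring.
exists (t' * u^-1); rewrite rmorphM /= -EuE -mulrA -rmorphM divrr //.
by rewrite rmorph1 mulr1.
Qed.

(* Modulo [P] the element [p ^+ i] is a multiple of [X], so that an element of
   the completion can be replaced by one of [R], coefficient after coefficient. *)
Lemma series_approximation (P : ps (completion pi)) u i : invertible u ->
  P 0%N = u * p ^+ i ->
  forall G, exists (g : ps R) s, iota g = G + s * P.
Proof.
move=> [u' uu'] P0 G.
pose stuff (s : nat -> completion pi) n := \sum_(j < n) s j * P (n - j)%N.
have stuff_ext n s s' : (forall j, (j < n)%N -> s j = s' j) -> stuff s n = stuff s' n.
  by move=> ss; apply: eq_bigr => j _; rewrite ss.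
have [n s s' ss' [r rE]|n s|s sP] := @course_of_values (completion pi) 0
  (fun n s => exists r, cinj pi r = G n + (stuff s n + s n * P 0%N)).
- by exists r; rewrite rE ss' // (stuff_ext n s s') // => j /ltnW/ss'.
- have [r [y /eqP]] := completion_dense pi_neq0 i (G n + stuff s n).
  rewrite subr_eq => /eqP rE.
  (* The value of [s n] is chosen to make [s n * P 0 = - p ^+ i * y], which leaves exactly [r]. *)
  exists (- (u' * y)), r; rewrite eqxx (stuff_ext n _ s); last first.
    by move=> j lt_jn; rewrite ltn_eqF.
  rewrite P0; transitivity (G n + stuff s n - (u * u') * (p ^+ i * y)).
    by rewrite uu' mul1r rE addrAC subrr add0r.
  by ring.
have /choice[g gP] := sP.
by exists g, s; apply/psP => n; rewrite psDE psME big_ord_recr /= subnn -gP.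
Qed.

(** Write [u' G = p ^+ i + X G1] and approximate [G1] modulo [G] by a series over [R],
    [iota g = G1 + s G]. Then [(u' + X s) G = p ^+ i + X iota g]. *)
Lemma series_associate (G : ps (completion pi)) u i :
  invertible u -> G 0%N = u * p ^+ i ->
  exists (V : ps (completion pi)) (g : ps R),
    [/\ invertible V, g 0%N = pi ^+ i & V * G = iota g].
Proof.
move=> u_inv G0; have [u' uu'] := u_inv.
have [g [s gE]] := series_approximation u_inv G0 (psshift 1 (psC u' * G)).
exists (psC u' + psXn _ 1 * s), (psC (pi ^+ i) + psXn _ 1 * g); split.
- by apply/ps_invertible; rewrite psDE psXnME addr0; exists u; rewrite mulrC.
- by rewrite psDE psXnME addr0.
have -> : iota (psC (pi ^+ i) + psXn _ 1 * g) = psC (p ^+ i) + psXn _ 1 * iota g.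
  rewrite psmapD psmapM; congr (_ + _ * _); apply/psP => n; rewrite /psmap /psC.
    by case: eqP; rewrite ?rmorph0 ?rmorphXn.
  by rewrite /psXn rmorph_nat.
rewrite gE mulrDl {1}[psC u' * G]psC_shift psCME G0 mulrA [u' * u]mulrC uu' mul1r.
by ring.
Qed.

(** * Transfer between a series and its Weierstrass polynomial *)

Section Preparation.
Variables (f : ps R) (u : R) (m : nat) (U P : ps (completion pi)).
Hypotheses (uU : u \is a GRing.unit) (f0 : f 0%N = u * pi ^+ m).
Hypotheses (U_inv : invertible U) (PW : is_weierstrass p P).
Hypothesis fE : iota f = U * P.

Definition poly_invertible (G : ps (completion pi)) :=
  exists2 G', is_poly G' & G * G' = 1.

Let quotient_poly s : is_poly (P * s) -> is_poly s.
Proof. by apply: weierstrass_quotient_poly PW; apply: completion_separated. Qed.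

(** The inverse [G'] satisfies [P * G' = H], a polynomial, so it is a polynomial itself. *)
Let factor_poly_invertible G H : is_poly H -> P = G * H -> invertible G ->
  poly_invertible G.
Proof.
move=> Hpoly PGH [G' GG']; exists G' => //; apply: quotient_poly.
by rewrite PGH mulrAC GG' mul1r.
Qed.

(** The constant terms of [G] and [H] divide a unit times [p ^+ m], so both are units times powers
    of [p]. Hence [G] and [H] are associate to series [g] and [h] over [R], and [f = e g h] with [e]
    descending to [R]. Irreducibility of [f] makes [g] or [h] a unit. *)
Lemma irreducible_series_poly G H :
    (forall g h, f = g * h -> invertible g \/ invertible h) ->
    is_poly G -> is_poly H -> P = G * H ->
  poly_invertible G \/ poly_invertible H.
Proof.
move=> f_irr Gpoly Hpoly PGH.
have u_inv : invertible (cinj pi u).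
  by exists (cinj pi u^-1); rewrite -rmorphM divrr // rmorph1.
have UGH : U 0%N * (G 0%N * H 0%N) = cinj pi u * p ^+ m.
  by rewrite -(psM0E G H) -PGH -(psM0E U P) -fE /psmap f0 rmorphM rmorphXn.
have [i [v [v_inv G0]]] : exists i v, invertible v /\ G 0%N = v * p ^+ i.
  apply: (factor_of_prime_power (y := U 0%N * H 0%N) (completion_regular pi_neq0)
    completion_dichotomy u_inv (m := m)); by rewrite -UGH mulrCA.
have [j [w [w_inv H0]]] : exists j w, invertible w /\ H 0%N = w * p ^+ j.
  apply: (factor_of_prime_power (y := U 0%N * G 0%N) (completion_regular pi_neq0)
    completion_dichotomy u_inv (m := m)); rewrite -UGH; ring.
have [V [g [[V' VV'] g0 gE]]] := series_associate v_inv G0.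
have [W [h [[W' WW'] h0 hE]]] := series_associate w_inv H0.
have fgh : iota f = U * V' * W' * iota (g * h).
  rewrite psmapM -gE -hE fE PGH.
  transitivity (U * (V * V') * (W * W') * (G * H)); last by ring.
  by rewrite VV' WW' !mulr1.
have [|e eE] := series_descent (n := (i + j)%N) (unitr1 R) _ fgh.
  by rewrite psM0E g0 h0 mul1r exprD.
have f_egh : f = (e * g) * h.
  by apply: iota_inj; rewrite -mulrA psmapM -eE.
have iota_invertible k : invertible k -> invertible (iota k).
  by move=> [k' kk']; exists (iota k'); rewrite -psmapM kk' psmap1.
have [/invertibleM[_]|] := f_irr _ _ f_egh => /iota_invertible.
  rewrite -gE => /invertibleM[_ G_inv]; left.
  exact: factor_poly_invertible PGH G_inv.
rewrite -hE => /invertibleM[_ H_inv]; right.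
by apply: (factor_poly_invertible Gpoly) H_inv; rewrite mulrC.
Qed.

Lemma invertible_cinj_factor x y :
  x * y = u * pi ^+ m -> invertible (cinj pi x) -> invertible x.
Proof.
move=> xy [z xz]; apply/invertible_unit.
apply: prime_power_cofactor_unit uU xy _ => -[x' xE].
apply: completion_p_not_invertible; exists (cinj pi x' * z).
by rewrite -xz xE rmorphM mulrA.
Qed.

(** For [f = g h], let [P1] be the Weierstrass polynomial of [g]. It divides [P] as a series, hence
    as a polynomial. A unit among [P1] and its cofactor makes [g] or [h] a unit over the completion,
    and then over [R] because the constant terms divide [u * pi ^+ m]. *)
Lemma irreducible_poly_series :
    (forall G H, is_poly G -> is_poly H -> P = G * H ->
       poly_invertible G \/ poly_invertible H) ->
  forall g h, f = g * h -> invertible g \/ invertible h.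
Proof.
move=> P_irr g h fgh; have [U' UU'] := U_inv.
have PE : P = U' * (iota g * iota h).
  by rewrite -psmapM -fgh fE mulrA [U' * U]mulrC UU' mul1r.
(* If [p] divided [g], it would divide [P], which has a coefficient equal to 1. *)
have gN : exists i, ~ multiple p (iota g i).
  apply: contrapT => /forallNP gN.
  have [d [Pd _ _]] := PW; apply: completion_p_not_invertible.
  rewrite -Pd; move: d {Pd}; apply/ps_multiple; rewrite PE.
  apply: multipleMr; apply: multipleMl; apply/ps_multiple => i.
  exact: contrapT (gN i).
have [U1 [P1 [U1_inv P1W gE]]] := weierstrass_preparation
  (@completion_separated _ pi) (@completion_complete _ pi) completion_dichotomy gN.
have P1K : P = P1 * (U' * U1 * iota h) by rewrite PE gE; ring.
have Kpoly : is_poly (U' * U1 * iota h).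
  apply: weierstrass_quotient_poly P1W _; first exact: completion_separated.
  by rewrite -P1K; apply: is_weierstrass_poly PW.
have poly_inv G : poly_invertible G -> invertible G by move=> [G' _ GG']; exists G'.
have gh0 : g 0%N * h 0%N = u * pi ^+ m by rewrite -(psM0E g h) -fgh.
have [|] := P_irr _ _ (is_weierstrass_poly P1W) Kpoly P1K => /poly_inv.
  move=> P1_inv; left; apply/ps_invertible/(invertible_cinj_factor gh0).
  suff : invertible (iota g) by move/ps_invertible.
  by rewrite gE; apply/invertibleM.
move=> /invertibleM[_ /ps_invertible h_inv]; right.
by apply/ps_invertible; apply: invertible_cinj_factor h_inv; rewrite mulrC; exact: gh0.
Qed.

Definition poly_congruent (G H : ps (completion pi)) :=
  exists2 Q, is_poly Q & G - H = P * Q.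

(** The quotient of a polynomial by [P] is a polynomial, so congruences in [S[X]] may be tested in
    [S[[X]]]. *)
Lemma poly_congruentP G H : is_poly G -> is_poly H ->
  poly_congruent G H <-> multiple P (G - H).
Proof.
move=> [M GM] [N HN]; split=> [[Q _]|[Q GHE]]; first by exists Q.
exists Q => //; apply: quotient_poly; rewrite -GHE; exists (M + N)%N => i le_i.
by rewrite psBE GM ?HN ?subr0 //; apply: leq_trans le_i; rewrite ?leq_addr ?leq_addl.
Qed.

Lemma series_poly_remainder g : exists2 G, is_poly G & multiple P (G - iota g).
Proof.
have [d Pd] := is_weierstrass_distinguished PW.
have [q qP] := weierstrass_division (@completion_separated _ pi)
  (@completion_complete _ pi) (iota g) Pd.
exists (iota g - q * P); first by exists d.
by exists (- q); ring.
Qed.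

(** Injectivity of [R[[X]]/(f) -> S[[X]]/(P)]: the quotient of [iota g] by [iota f] descends to
    [R]. *)
Lemma series_multiple g : multiple P (iota g) <-> multiple f g.
Proof.
have [U' UU'] := U_inv; split=> [[s gE]|[q ->]]; last first.
  by exists (U * iota q); rewrite psmapM fE; ring.
have gE' : iota g = s * U' * iota f.
  transitivity (P * s * (U * U')); first by rewrite UU' mulr1.
  by rewrite fE; ring.
have [e eE] := series_descent uU f0 gE'.
by exists e; apply: iota_inj; rewrite psmapM -eE gE' mulrC.
Qed.

(** [P 0] divides a unit times [p ^+ m], so it is a unit times a power of [p] and the approximation
    modulo [P] applies. *)
Lemma series_surjective G : exists g, multiple P (iota g - G).
Proof.
have P0E : U 0%N * P 0%N = cinj pi u * p ^+ m.
  by rewrite -(psM0E U P) -fE /psmap f0 rmorphM rmorphXn.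
have u_inv : invertible (cinj pi u).
  by exists (cinj pi u^-1); rewrite -rmorphM divrr // rmorph1.
have [i [v [v_inv P0]]] := factor_of_prime_power (completion_regular pi_neq0)
  completion_dichotomy u_inv (etrans (mulrC _ _) P0E).
have [g [s gE]] := series_approximation v_inv P0 G.
by exists g, s; rewrite gE; ring.
Qed.

End Preparation.
End Prime.
End PID.

(** * Series given by representatives *)

Section Representatives.
Variables (R : idomainType) (pi : R).
Implicit Types (f g : ps R) (F G H P : cps R) (A : ps (completion pi)).

Local Notation p := (cinj pi pi).
Local Notation iota := (psmap (cinj pi)).
Local Notation valid := (cps_valid pi).

Lemma ps_unitP f : ps_unit f <-> invertible f.
Proof. by split=> -[g fg]; exists g; apply/psP. Qed.

Lemma ps_dvdCP (a : R) f : ps_dvdC a f <-> forall n, multiple a (f n).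
Proof. by split=> [[g fE] n|/choice[g gP]]; [exists (g n)|exists g]. Qed.

Lemma ps_irreducibleP f : ps_irreducible f <->
  [/\ f <> 0, ~ invertible f &
      forall g h, f = g * h -> invertible g \/ invertible h].
Proof.
have irrE g h : (ps_eq f (ps_mul g h) -> ps_unit g \/ ps_unit h) <->
    (f = (g : ps R) * h -> invertible (g : ps R) \/ invertible (h : ps R)).
  by split=> irr /psP/irr; rewrite !ps_unitP.
split=> [[f0 [fN irr]]|[f0 fN irr]].
  split=> [/psP fE|/ps_unitP|g h]; [exact: f0|by []|exact/irrE/irr].
split=> [/psP|]; first exact: f0.
by split=> [/ps_unitP|g h]; [|exact/irrE/irr].
Qed.

(** Passes from the representatives of the statement to series over the ring [completion]. It is
    faithful only on [valid] families, since [cclass] sends other coefficients to 0. *)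
Definition cps_class F : ps (completion pi) := fun i => cclass pi (F i).
Definition cps_repr A : cps R := fun i => crepr (A i).

Lemma cps_repr_valid A : valid (cps_repr A).
Proof. by move=> i; apply: crepr_cauchy. Qed.

Lemma cps_reprK A : cps_class (cps_repr A) = A.
Proof. by apply/psP => i; apply: creprK. Qed.

Lemma cps_eqP F G : valid F -> valid G ->
  cps_eq pi F G <-> cps_class F = cps_class G.
Proof.
move=> FP GP; rewrite -psP; split=> FG i; first by apply/cclass_eq.
exact/cclass_eq/FG.
Qed.

Lemma cps_mul_valid F G : valid F -> valid G -> valid (cps_mul F G).
Proof.
by move=> FP GP i; apply: cauchy_sum => j; apply: cauchyM.
Qed.

Lemma cps_classM F G : valid F -> valid G ->
  cps_class (cps_mul F G) = cps_class F * cps_class G.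
Proof.
move=> FP GP; apply/psP => i; rewrite psME /cps_class /cps_mul.
rewrite (cclass_sum (F := fun (j : 'I_i.+1) n => F j n * G (i - j)%N n)) => [|j].
  by apply: eq_bigr => j _; rewrite cclassM.
exact: cauchyM.
Qed.

Lemma cps_sub_valid F G : valid F -> valid G -> valid (cps_sub F G).
Proof. by move=> FP GP i; apply: cauchyD => //; apply: cauchyN. Qed.

Lemma cps_classB F G : valid F -> valid G ->
  cps_class (cps_sub F G) = cps_class F - cps_class G.
Proof. by move=> FP GP; apply/psP => i; rewrite psBE -cclassB. Qed.

Lemma cps_add_valid F G : valid F -> valid G -> valid (cps_add F G).
Proof. by move=> FP GP i; apply: cauchyD. Qed.

Lemma cps_classD F G : valid F -> valid G ->
  cps_class (cps_add F G) = cps_class F + cps_class G.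
Proof. by move=> FP GP; apply/psP => i; rewrite psDE -cclassD. Qed.

Lemma cps_of_ps_valid f : valid (cps_of_ps f).
Proof. by move=> i; apply: cauchy_const. Qed.

Lemma cps_class_of_ps f : cps_class (cps_of_ps f) = iota f.
Proof. by []. Qed.

Lemma cps_one_valid : valid (@cps_one R).
Proof. by move=> i; apply: cauchy_const. Qed.

Lemma cps_class1 : cps_class (@cps_one R) = 1.
Proof. by apply/psP => i; rewrite ps1E -(rmorph_nat (cinj pi)). Qed.

Lemma cps_zero_valid : valid (@cps_zero R).
Proof. by move=> i; apply: cauchy_const. Qed.

Lemma cpoly_eltP F : cpoly_elt pi F <-> valid F /\ is_poly (cps_class F).
Proof.
split=> -[FP [N FN]]; split=> //; exists N => i le_Ni.
  by apply/cclass_eq; [exact: FP|exact: cauchy_const|exact: FN].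
by apply/cclass_eq; [exact: FP|exact: cauchy_const|exact: FN].
Qed.

Lemma cps_repr_poly A : is_poly A -> cpoly_elt pi (cps_repr A).
Proof.
by move=> Apoly; apply/cpoly_eltP; rewrite cps_reprK; split=> //; apply: cps_repr_valid.
Qed.

Lemma cps_mul_eqP F G H : valid F -> valid G -> valid H ->
  cps_eq pi F (cps_mul G H) <-> cps_class F = cps_class G * cps_class H.
Proof.
by move=> FP GP HP; rewrite cps_eqP ?cps_classM //; apply: cps_mul_valid.
Qed.

Lemma cps_mul_oneP F G : valid F -> valid G ->
  cps_eq pi (cps_mul F G) (@cps_one R) <-> cps_class F * cps_class G = 1.
Proof.
move=> FP GP; rewrite cps_eqP ?cps_classM ?cps_class1 //.
  exact: cps_mul_valid.
exact: cps_one_valid.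
Qed.

Lemma cps_unitP F : valid F -> cps_unit pi F <-> invertible (cps_class F).
Proof.
move=> FP; split=> [[G [GP /cps_mul_oneP FG]]|[A FA]].
  by exists (cps_class G); apply: FG.
exists (cps_repr A); split; first exact: cps_repr_valid.
by apply/cps_mul_oneP; rewrite ?cps_reprK //; apply: cps_repr_valid.
Qed.

Lemma cpoly_unitP F : valid F -> cpoly_unit pi F <-> poly_invertible (cps_class F).
Proof.
move=> FP; split=> [[G [/cpoly_eltP[GP Gpoly] /cps_mul_oneP FG]]|[A Apoly FA]].
  by exists (cps_class G) => //; apply: FG.
exists (cps_repr A); split; first exact: cps_repr_poly.
by apply/cps_mul_oneP; rewrite ?cps_reprK //; apply: cps_repr_valid.
Qed.

Lemma cpoly_irreducibleP P : cpoly_elt pi P ->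
  cpoly_irreducible pi P <->
  [/\ cps_class P <> 0, ~ poly_invertible (cps_class P) &
      forall A B, is_poly A -> is_poly B -> cps_class P = A * B ->
        poly_invertible A \/ poly_invertible B].
Proof.
move=> Pelt; have [PP Ppoly] := (cpoly_eltP P).1 Pelt; split.
  move=> [_ [P0 [PN irr]]]; split.
  - by move=> P0'; apply: P0; apply/cps_eqP => //; apply: cps_zero_valid.
  - by rewrite -cpoly_unitP.
  move=> A B Apoly Bpoly PAB.
  have := irr _ _ (cps_repr_poly Apoly) (cps_repr_poly Bpoly).
  rewrite cps_mul_eqP ?cps_reprK //; try exact: cps_repr_valid.
  by rewrite !cpoly_unitP ?cps_reprK; try exact: cps_repr_valid; apply.
move=> [P0 PN irr]; split=> //; split.
  by move=> /cps_eqP P0'; apply: P0; rewrite P0' //; apply: cps_zero_valid.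
split; first by rewrite cpoly_unitP.
move=> G H /cpoly_eltP[GP Gpoly] /cpoly_eltP[HP Hpoly].
by rewrite cps_mul_eqP // !cpoly_unitP //; apply: irr.
Qed.

Lemma in_pi_idealP c : cauchy pi c -> in_pi_ideal pi c <-> multiple p (cclass pi c).
Proof.
move=> cP; split=> [[d [dP cd]]|[x xE]].
  exists (cclass pi d); rewrite -[p]expr1 cinjX_M //.
  by apply/cclass_eq => //; apply: cauchyZ.
exists (crepr x); split; first exact: crepr_cauchy.
apply/cclass_eq => //; first exact/cauchyZ/crepr_cauchy.
rewrite xE -[p]expr1 -[in LHS](creprK x) cinjX_M //; exact: crepr_cauchy.
Qed.

Lemma weierstrass_polyP f P : weierstrass_poly pi f P <->
  [/\ valid P, is_weierstrass p (cps_class P) &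
      exists2 U, invertible U & iota f = U * cps_class P].
Proof.
split.
  move=> [/cpoly_eltP[PP _] [[d [Pd [high low]]] [U [UP [U_inv fE]]]]]; split=> //.
    exists d; split=> [|i lt_di|i lt_id].
    - by apply/cclass_eq => //; apply: cauchy_const.
    - by apply/cclass_eq; [|exact: cauchy_const|exact: high].
    - exact/in_pi_idealP/low.
  exists (cps_class U); first exact/cps_unitP.
  by apply/cps_mul_eqP => //; apply: cps_of_ps_valid.
move=> [PP PW [U U_inv fE]]; split.
  by apply/cpoly_eltP; split=> //; apply: is_weierstrass_poly PW.
split.
  have [d [Pd high low]] := PW; exists d; split.
    by apply/cclass_eq => //; apply: cauchy_const.
  split=> i lt_i; last by apply/in_pi_idealP => //; apply: low.
  by apply/cclass_eq; [|exact: cauchy_const|exact: high].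
exists (cps_repr U); split; first exact: cps_repr_valid.
split; first by apply/cps_unitP; rewrite ?cps_reprK //; apply: cps_repr_valid.
apply/cps_mul_eqP => //; rewrite ?cps_reprK //; first exact: cps_of_ps_valid.
exact: cps_repr_valid.
Qed.

Lemma cpoly_congP P G H : valid P -> valid G -> valid H ->
  cpoly_cong pi P G H <->
  poly_congruent (cps_class P) (cps_class G) (cps_class H).
Proof.
move=> PP GP HP; have GHP := cps_sub_valid GP HP; split.
  move=> [Q [/cpoly_eltP[QP Qpoly] /cps_mul_eqP GHQ]]; exists (cps_class Q) => //.
  by rewrite -cps_classB // GHQ.
move=> [Q Qpoly GHQ]; exists (cps_repr Q); split; first exact: cps_repr_poly.
apply/cps_mul_eqP; rewrite ?cps_classB ?cps_reprK //.
exact: cps_repr_valid.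
Qed.

End Representatives.

(** * The quotient isomorphism and the cases of the irreducibility criterion *)

Section Main.
Variables (R : idomainType) (pid : is_PID R) (f : ps R).

Section Power.
Variables (pi u : R) (m : nat).
Hypotheses (piP : prime_elt pi) (uU : u \is a GRing.unit).
Hypothesis f0 : f 0%N = u * pi ^+ m.

Local Notation p := (cinj pi pi).
Local Notation iota := (psmap (cinj pi)).

Lemma weierstrass_poly_exists : ~ ps_dvdC pi f ->
  exists P : cps R, weierstrass_poly pi f P.
Proof.
rewrite ps_dvdCP => /existsNP[i fi].
have [|U [P [U_inv PW fE]]] := weierstrass_preparation (f := iota f)
  (@completion_separated _ pi) (@completion_complete _ pi)
  (completion_dichotomy pid piP).
  exists i; rewrite -[p]expr1 => /cinj_multiple; by rewrite expr1.
exists (cps_repr P); apply/weierstrass_polyP; rewrite cps_reprK.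
by split=> //; [exact: cps_repr_valid|exists U].
Qed.

(** [Phi g] is a polynomial congruent to [iota g] modulo [P], obtained by Weierstrass division. Each
    clause then becomes a congruence of series modulo [P]. *)
Lemma weierstrass_poly_quotient P : weierstrass_poly pi f P ->
  quotient_iso_RX pi f P.
Proof.
move=> /weierstrass_polyP[PP PW [U U_inv fE]].
have /choice[Phi PhiP] : forall g : ps R, exists G,
    is_poly G /\ multiple (cps_class pi P) (G - iota g).
  by move=> g; have [G Gpoly GP] := series_poly_remainder PW g; exists G.
have congP G H : cpoly_elt pi G -> cpoly_elt pi H ->
    cpoly_cong pi P G H <->
    multiple (cps_class pi P) (cps_class pi G - cps_class pi H).
  move=> /cpoly_eltP[GP ?] /cpoly_eltP[HP ?].
  by rewrite cpoly_congP // (poly_congruentP PW).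
have Phi_elt g : cpoly_elt pi (cps_repr (Phi g)) by apply/cps_repr_poly/(PhiP g).1.
have Phi_valid g : cps_valid pi (cps_repr (Phi g)) by apply: cps_repr_valid.
have PhiE g : exists s, Phi g = iota g + cps_class pi P * s.
  by have [_ [s sE]] := PhiP g; exists s; rewrite -sE; ring.
have sum_elt G H : cpoly_elt pi G -> cpoly_elt pi H ->
    cpoly_elt pi (cps_add G H).
  move=> /cpoly_eltP[GP [M GM]] /cpoly_eltP[HP [N HN]]; apply/cpoly_eltP.
  split; first exact: cps_add_valid.
  exists (M + N)%N => i le_i; rewrite cps_classD // psDE GM ?HN ?addr0 //; lia.
have mul_elt G H : cpoly_elt pi G -> cpoly_elt pi H ->
    cpoly_elt pi (cps_mul G H).
  move=> /cpoly_eltP[GP Gpoly] /cpoly_eltP[HP Hpoly]; apply/cpoly_eltP.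
  split; first exact: cps_mul_valid.
  by rewrite cps_classM //; apply: is_polyM.
exists (fun g => cps_repr (Phi g)); split=> //; split=> [g h|].
  rewrite congP // !cps_reprK.
  have [s ->] := PhiE g; have [t ->] := PhiE h.
  have -> : multiple (cps_class pi P) (iota g + cps_class pi P * s -
      (iota h + cps_class pi P * t)) <->
      multiple (cps_class pi P) (iota ((g : ps R) - (h : ps R))).
    rewrite psmapB; split=> [[x xE]|[x xE]].
      by exists (x - s + t); rewrite mulrDr mulrBr -xE; ring.
    by exists (x + s - t); rewrite mulrBr mulrDr -xE; ring.
  rewrite (series_multiple pid piP uU f0 U_inv fE).
  by split=> -[q qE]; exists q; apply/psP.
split=> [G /[dup] Gelt /cpoly_eltP[GP _]|].
  have [g [s sE]] := series_surjective pid piP uU f0 fE (cps_class pi G).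
  exists g; apply/congP => //; rewrite cps_reprK; have [t ->] := PhiE g.
  by exists (s + t); rewrite mulrDr -sE; ring.
split=> [g h|].
  apply/congP => //; first exact: sum_elt.
  rewrite cps_classD // !cps_reprK.
  have [r ->] := PhiE g; have [s ->] := PhiE h; have [t ->] := PhiE (ps_add g h).
  by exists (t - r - s); rewrite -[ps_add g h]/((g : ps R) + (h : ps R)) psmapD; ring.
split=> [g h|].
  apply/congP => //; first exact: mul_elt.
  rewrite cps_classM // !cps_reprK.
  have [r ->] := PhiE g; have [s ->] := PhiE h; have [t ->] := PhiE (ps_mul g h).
  exists (t - r * iota h - s * iota g - r * cps_class pi P * s).
  by rewrite -[ps_mul g h]/((g : ps R) * (h : ps R)) psmapM; ring.
split=> [|q].
  apply/congP => //.
    apply/cpoly_eltP; split; first exact: cps_one_valid.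
    by exists 1%N => -[|i] // _; rewrite cps_class1.
  have [s] := PhiE (@ps_one R); rewrite cps_reprK cps_class1 => ->.
  by rewrite -[@ps_one R]/(1 : ps R) psmap1; exists s; ring.
apply/congP => //.
  apply/cpoly_eltP; split; first exact: cps_of_ps_valid.
  exists (size q) => i le_i; rewrite cps_class_of_ps /psmap /ps_of_poly.
  by rewrite nth_default // rmorph0.
rewrite cps_reprK cps_class_of_ps; have [s ->] := PhiE (ps_of_poly q).
by exists s; ring.
Qed.

End Power.

Lemma irreducible_series_constant0 :
  ps_irreducible f -> f 0%N = 0 -> f 1%N \is a GRing.unit.
Proof.
move=> /ps_irreducibleP[_ _ f_irr] f0.
have fE : f = psXn R 1 * psshift 1 f.
  rewrite {1}[f]psC_shift f0 [X in X + _](_ : _ = 0) ?add0r //.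
  by apply/psP => n; rewrite /psC; case: eqP.
have [/ps_invertible[y]|/ps_invertible] := f_irr _ _ fE.
  by rewrite mul0r => /eqP; rewrite eq_sym oner_eq0.
by move/invertible_unit.
Qed.

(** Write [f 0 = pi ^+ m * c] with [pi] a prime divisor of [f 0] not dividing [c]. The factors are
    coprime, so [f] factors with these constant terms; as [pi ^+ m] is not a unit, [c] is one. *)
Lemma irreducible_series_prime_power : ps_irreducible f -> f 0%N != 0 ->
  exists pi m, prime_elt pi /\ assocR (f 0%N) (pi ^+ m).
Proof.
move=> /ps_irreducibleP[_ fN f_irr] f0.
have f0N : f 0%N \isn't a GRing.unit.
  by apply/negP => /invertible_unit/ps_invertible.
have [pi [piP pif0]] := prime_divisor pid f0 f0N.
have [m [c [f0E pic]]] := prime_power_part pid piP f0.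
exists pi, m; split=> //.
have m_gt0 : (0 < m)%N.
  by rewrite lt0n; apply/eqP => m0; apply: pic; move: pif0; rewrite f0E m0 mul1r.
have piXN : ~ invertible (pi ^+ m).
  rewrite -(prednK m_gt0) exprS => /invertibleM[[y piy] _].
  by apply: (prime_not_multiple1 piP); exists y.
have [a [b ab1]] := bezout_primeX pid piP m pic.
rewrite addrC in ab1.
have [g [h [fE g0 h0]]] := coprime_factorization f0E ab1.
have [/ps_invertible|/ps_invertible] := f_irr _ _ fE; rewrite ?g0 ?h0 //.
by move/invertible_unit => cU; exists c; rewrite mulrC.
Qed.

(** In [f = g h] one constant term vanishes, and then the other divides [f 1]. *)
Lemma linear_series_irreducible :
  f 0%N = 0 -> f 1%N \is a GRing.unit -> ps_irreducible f.
Proof.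
move=> f0 f1; apply/ps_irreducibleP; split.
- by move=> fE; move: f1; rewrite fE unitr0.
- move/ps_invertible; rewrite f0 => -[y].
  by rewrite mul0r => /eqP; rewrite eq_sym oner_eq0.
move=> g h fE; move: f0 f1.
rewrite fE psM0E psME !big_ord_recl big_ord0 addr0 /=.
move=> /eqP; rewrite mulf_eq0 => /orP[]/eqP ->.
  rewrite mul0r add0r => /invertible_unit/invertibleM[_ h0].
  by right; apply/ps_invertible.
rewrite mulr0 addr0 => /invertible_unit/invertibleM[g0 _].
by left; apply/ps_invertible.
Qed.

(** In [f = g h] the prime divides one of the two constant terms; cancelling it shows that the other
    divides [c]. *)
Lemma constant_prime_irreducible pi : prime_elt pi ->
  (exists2 c, c \is a GRing.unit & f 0%N = pi * c) -> ps_irreducible f.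
Proof.
move=> piP [c cU f0]; have [pi0 [_ pi_prime]] := piP.
apply/ps_irreducibleP; split.
- move=> fE; move/eqP: f0; rewrite fE eq_sym mulf_eq0 (negPf pi0) /=.
  by apply/negP; apply: contraTneq cU => ->; rewrite unitr0.
- rewrite ps_invertible f0 => /invertibleM[[y piy] _].
  by apply: (prime_not_multiple1 piP); exists y.
move=> g h fgh.
have gh0 : g 0%N * h 0%N = pi * c by rewrite -(psM0E g h) -fgh.
have [|[x gE]|[x hE]] := pi_prime (g 0%N) (h 0%N).
- by exists c; rewrite gh0 mulrC.
- right; apply/ps_invertible.
  suff /invertibleM[] : invertible (x * h 0%N) by [].
  suff -> : x * h 0%N = c by apply/invertible_unit.
  by apply: (mulfI pi0); rewrite -gh0 gE; ring.
- left; apply/ps_invertible.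
  suff /invertibleM[] : invertible (x * g 0%N) by [].
  suff -> : x * g 0%N = c by apply/invertible_unit.
  by apply: (mulfI pi0); rewrite -gh0 hE; ring.
Qed.

Lemma irreducible_series_multiple pi (f' : ps R) : prime_elt pi ->
    ps_irreducible f -> ps_eq f (fun n => pi * f' n) ->
  ~ ps_dvdC pi f' /\ f' 0%N \is a GRing.unit.
Proof.
move=> piP /ps_irreducibleP[_ _ f_irr] f'E.
have fE : f = psC pi * f' by apply/psP => n; rewrite psCME.
have [/ps_invertible[y piy]|/ps_invertible f'0] := f_irr _ _ fE.
  by case: (prime_not_multiple1 piP); exists y.
split; last exact/invertible_unit.
have [y f'y] := f'0 => /ps_dvdCP/(_ 0%N) pif'; apply: (prime_not_multiple1 piP).
by rewrite -f'y; apply: multipleMl.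
Qed.

Lemma weierstrass_poly_irreducible pi u m P : prime_elt pi ->
    u \is a GRing.unit -> f 0%N = u * pi ^+ m -> weierstrass_poly pi f P ->
  ps_irreducible f <-> cpoly_irreducible pi P.
Proof.
move=> piP uU f0 PW; have [Pelt _] := PW.
have /weierstrass_polyP[PP PWS [U U_inv fE]] := PW.
rewrite cpoly_irreducibleP // ps_irreducibleP; split=> [[_ fN f_irr]|[P0 PN P_irr]].
  split; last 1 first.
  - by move=> A B; exact: (irreducible_series_poly pid piP uU f0 PWS fE f_irr).
  - move=> P0; have [d [Pd _ _]] := PWS; apply: (completion_p_not_invertible piP).
    by rewrite -Pd P0; exists 0; rewrite mulr0.
  (* If [P] were a unit, so would be [iota f]; its constant term would then be a unit already in
     [R]. *)
  - move=> [P' _ PP']; apply: fN; apply/ps_invertible.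
    apply: (invertible_cinj_factor pid piP uU (m := m) (y := 1)).
      by rewrite mulr1.
    suff /ps_invertible : invertible (psmap (cinj pi) f) by [].
    by rewrite fE; apply/invertibleM; split=> //; exists P'.
split; last exact: (irreducible_poly_series pid piP uU f0 U_inv PWS fE P_irr).
- have pi0 : pi != 0 by case: piP.
  move=> f_0; move/eqP: f0.
  rewrite f_0 eq_sym mulf_eq0 expf_eq0 (negPf pi0) andbF orbF.
  by apply/negP; apply: contraTneq uU => ->; rewrite unitr0.
- move=> [f' ff]; apply: PN.
  have PU : cps_class pi P * (U * psmap (cinj pi) f') = 1.
    by rewrite mulrCA mulrA -fE -psmapM ff psmap1.
  exists (U * psmap (cinj pi) f') => //.
  (* The series inverse of [P] is a polynomial because its product with [P] is the polynomial 1. *)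
  apply: weierstrass_quotient_poly PWS _; first exact: completion_separated.
  by rewrite PU; exists 1%N => -[].
Qed.

End Main.

Theorem theorem1p4 (R : idomainType) (hPID : is_PID R) (f : pseries R) :
  (ps_irreducible f <->
     ((f 0%N = 0 /\ f 1%N \is a GRing.unit) \/
      (exists pi : R, prime_elt pi /\ (exists m : nat, assocR (f 0%N) (pi ^+ m)) /\
         ((exists f' : pseries R, ps_eq f (fun n => pi * f' n) /\
              ~ ps_dvdC pi f' /\ f' 0%N \is a GRing.unit) \/
          (~ ps_dvdC pi f /\
              exists P : cps R, weierstrass_poly pi f P /\ cpoly_irreducible pi P)))))
  /\
  (forall pi : R, prime_elt pi -> (exists m : nat, assocR (f 0%N) (pi ^+ m)) ->
     ~ ps_dvdC pi f ->
     exists P : cps R, weierstrass_poly pi f P /\ quotient_iso_RX pi f P).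
Proof.
split; last first.
  move=> pi piP [m [u [uU f0]]] pif.
  have [P PW] := weierstrass_poly_exists hPID piP pif.
  by exists P; split=> //; apply: weierstrass_poly_quotient f0 _ PW.
split=> [f_irr|[[f0 f1]|[pi [piP [[m [u [uU f0]]] f_cases]]]]].
- have [f0|/eqP f0] := pselect (f 0%N = 0); [left|right].
    by split=> //; apply: irreducible_series_constant0.
  have [pi [m [piP f0E]]] := irreducible_series_prime_power hPID f_irr f0.
  exists pi; split=> //; split; first by exists m.
  (* Divisibility of [f] by [pi] separates [k >= 1], where irreducibility forces [k = 1], from
     [k = 0]. *)
  have [[f' f'E]|pif] := pselect (ps_dvdC pi f); [left|right].
    by exists f'; split=> //; apply: irreducible_series_multiple f'E.
  split=> //; have [P PW] := weierstrass_poly_exists hPID piP pif; exists P.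
  have [u [uU f0u]] := f0E.
  by split=> //; apply/(weierstrass_poly_irreducible hPID piP uU f0u PW).
- exact: linear_series_irreducible.
- case: f_cases => [[f' [fE [_ f'0]]]|[_ [P [PW P_irr]]]].
    by apply: (constant_prime_irreducible piP); exists (f' 0%N).
  exact/(weierstrass_poly_irreducible hPID piP uU f0 PW).
Qed.
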